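(* Consider the $q$-state $p$-adic Potts model on the Cayley tree of order $k=3$, let $\theta=1+q/2$, let $m\in\{1,\dots,q-1\}$ and assume $q\ne2m$. Then $|\mathcal G(H)|\ge1+\binom{q}{m}$ if one of the following conditions is satisfied: a) $p=2$ and $\left|\frac{q}{2m}-1\right|_p<\frac14$; b) $p=3$ and $|m|_p\le|q|_p$; c) $p>3$, $|m|_p=|q|_p$ and $|q-2m|_p<|q|_p$; d) $|m|_p>|q|_p$ and $\sqrt{-3}$ exists in $\mathbb Q_p$.
   Context: $p$ is a prime, $\mathbb Q_p$ the field of $p$-adic numbers with norm $|\cdot|_p$. Cayley tree: $\Gamma^k=(V,L)$ is the infinite tree in which every vertex has exactly $k+1$ neighbours; $x^0\in V$ is a fixed root, $d$ the graph distance, $W_n=\{x\in V:d(x,x^0)=n\}$, $V_n=\bigcup_{j=0}^nW_j$. Potts model: spins take values in $\Phi=\{1,\dots,q\}$, $q\ge2$; the Hamiltonian is $H(\sigma)=J\sum_{\langle x,y\rangle\in L}\delta_{\sigma(x)\sigma(y)}$ with $J\in\mathbb Q_p$, $|J|_p<p^{-1/(p-1)}$, and $\theta=\exp_p(J)$. $H_n$ is the restriction of $H$ to $V_n$. $p$-adic Gibbs measure: a $p$-adic measure is a finitely additive $\mathbb Q_p$-valued function on an algebra of sets; it is a probability measure if the total mass is $1$. Given vectors $\tilde h_x=(\tilde h_{1,x},\dots,\tilde h_{q,x})\in\mathbb Q_p^q$, $x\in V$ (with entries in the domain of convergence of $\exp_p$), put $$\mu^{(n)}_{\tilde h}(\sigma_n)=Z_{n,\tilde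 h}^{-1}\exp_p\Big\{H_n(\sigma_n)+\sum_{x\in W_n}\tilde h_{\sigma_n(x),x}\Big\},\qquad \sigma_n\in\Phi^{V_n},$$ where $Z_{n,\tilde h}$ is the (nonzero) normalizing factor. If these are compatible, i.e. $\sum_{\omega_n\in\Phi^{W_n}}\mu^{(n)}_{\tilde h}(\sigma_{n-1}\vee\omega_n)=\mu^{(n-1)}_{\tilde h}(\sigma_{n-1})$ for all $n\ge1$ and $\sigma_{n-1}\in\Phi^{V_{n-1}}$ ($\vee$ is concatenation), they define a unique $p$-adic probability measure $\mu_{\tilde h}$ on the algebra of cylinder sets of $\Phi^V$, called a $p$-adic Gibbs measure. $\mathcal G(H)$ is the set of all $p$-adic Gibbs measures obtained in this way. *)

(* Defs.v *)
From HB Require Import structures.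
From mathcomp Require Import all_boot all_order all_algebra.
From mathcomp Require Import all_classical all_reals all_analysis.

Set Implicit Arguments.
Unset Strict Implicit.
Unset Printing Implicit Defensive.

Import Order.TTheory GRing.Theory Num.Theory.
Import numFieldNormedType.Exports.

Local Open Scope classical_set_scope.
Local Open Scope ring_scope.

Definition padic_abs_rat (R : realType) (p : nat) (r : rat) : R :=
  if r == 0 then 0
  else p%:R ^+ logn p `|denq r|%N / p%:R ^+ logn p `|numq r|%N.

(* For p prime, Q_p is the completion of (rat, |.|_p): a field, complete for an
   ultrametric absolute value, containing rat isometrically as a dense subset.
   These axioms determine it up to a unique isometric isomorphism. *)
Record padicField (R : realType) (p : nat) := PadicField {
  padic_sort :> fieldType;
  padic_norm : padic_sort -> R;
  padic_norm_ge0 : forall x, 0 <= padic_norm x;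
  padic_norm_eq0 : forall x, padic_norm x = 0 -> x = 0;
  padic_normM : forall x y, padic_norm (x * y) = padic_norm x * padic_norm y;
  padic_normD : forall x y,
    padic_norm (x + y) <= Num.max (padic_norm x) (padic_norm y);
  padic_norm_rat : forall r : rat, padic_norm (ratr r) = padic_abs_rat R p r;
  padic_rat_dense : forall x (e : R), 0 < e ->
    exists r : rat, padic_norm (x - ratr r) < e;
  padic_complete : forall u : nat -> padic_sort,
    (forall e : R, 0 < e -> exists N : nat, forall i j : nat,
       (N <= i)%N -> (N <= j)%N -> padic_norm (u i - u j) < e) ->
    exists l, padic_norm (u n - l) @[n --> \oo] --> (0 : R)
}.

Section Exponential.
Variables (R : realType) (p : nat) (K : padicField R p).

Definition exp_sums (x : K) (n : nat) : K := \sum_(i < n) x ^+ i / i`!%:R.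

Definition exp_lims (x : K) : set K :=
  [set l | padic_norm (exp_sums x n - l) @[n --> \oo] --> (0 : R)].

Definition exp_domain : set K := [set x | exp_lims x !=set0].

(* Junk value 0 outside exp_domain. *)
Definition padic_exp (x : K) : K := xget 0 (exp_lims x).

End Exponential.

(* The Cayley tree of order k, as the Cayley graph of the free product of k+1
   copies of Z/2: vertices are the words over k+1 letters without two equal
   consecutive letters, the root is the empty word, and the neighbours of a word
   are obtained by appending a letter or deleting the last one. *)
Section CayleyTree.
Variable k : nat.

Definition reduced (s : seq 'I_k.+1) : bool := sorted (fun a b => a != b) s.

Definition vertex := {s : seq 'I_k.+1 | reduced s}.
HB.instance Definition _ := SubType.on vertex.
HB.instance Definition _ := Countable.on vertex.

Definition root : vertex := Sub [::] isT.

Definition child (x y : vertex) : bool :=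
  [exists a : 'I_k.+1, val y == rcons (val x) a].

Definition adj (x y : vertex) : bool := child x y || child y x.

(* The graph distance to the root, see height_dist. *)
Definition height (x : vertex) : nat := size (val x).

Lemma child_height x y : child x y -> height y = (height x).+1.
Proof. by case/existsP=> a /eqP; rewrite /height => ->; rewrite size_rcons. Qed.

Lemma child_inj x y z : child x z -> child y z -> x = y.
Proof.
case/existsP=> a /eqP e /existsP[b /eqP]; rewrite e => /rcons_inj[xy _].
exact: val_inj.
Qed.

Lemma adj_sym : symmetric adj.
Proof. by move=> x y; rewrite /adj orbC. Qed.

Lemma reduced_rcons2 s a b :
  reduced (rcons (rcons s a) b) = reduced (rcons s a) && (a != b).
Proof.
by case: s => [|c s] /=; rewrite ?andbT // [path _ _ _]rcons_path last_rcons.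
Qed.

Lemma reduced_rcons s a : reduced (rcons s a) -> reduced s.
Proof. by case/lastP: s => // s b; rewrite reduced_rcons2 => /andP[]. Qed.

Lemma parent_exists x : (0 < height x)%N -> exists y, child y x.
Proof.
case: x => s; rewrite /height /=; case/lastP: s => // s a rs _.
exists (Sub s (reduced_rcons rs)); apply/existsP; exists a.
by rewrite /=.
Qed.

Lemma adj_regular x :
  exists f : 'I_k.+1 -> vertex, injective f /\ codom f =i adj x.
Proof.
case: x => s; case/lastP: s => [|s b] rs.
  have ra a : reduced [:: a] by [].
  exists (fun a => Sub [:: a] (ra a)); split=> [a c [] //|y].
  apply/codomP/idP => [[a ->]|].
    by apply/orP; left; apply/existsP; exists a.
  case/orP => /existsP[a /eqP /= e]; last by case: (val y) e.
  by exists a; apply: val_inj.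
pose x : vertex := Sub (rcons s b) rs.
pose g a := if a == b then s else rcons (rcons s b) a.
have rg a : reduced (g a).
  rewrite /g; case: eqVneq => [_|ab]; first exact: reduced_rcons rs.
  by rewrite reduced_rcons2 rs eq_sym.
exists (fun a => Sub (g a) (rg a)); split=> [a c /(congr1 val)|y].
  rewrite /= /g; case: eqVneq => [->|_]; case: eqVneq => [->|_] //.
  - by move=> /(congr1 size); rewrite !size_rcons => /eqP;
      rewrite -[X in X == _]addn0 -addn2 eqn_add2l.
  - by move=> /(congr1 size); rewrite !size_rcons => /eqP;
      rewrite -[X in _ == X]addn0 -addn2 eqn_add2l.
  - by case/rcons_inj.
apply/codomP/idP => [[a ->]|].
  rewrite unfold_in /adj /child /= /g; case: eqVneq => [_|_]; apply/orP.
    by right; apply/existsP; exists b; rewrite /=.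
  by left; apply/existsP; exists a; rewrite /=.
case/orP => /existsP[a /eqP /= e]; last first.
  exists b; apply: val_inj; rewrite /= /g eqxx.
  by case/rcons_inj: e.
exists a; apply: val_inj; rewrite /= e /g; case: eqVneq => // ab.
by have := valP y; rewrite /= e reduced_rcons2 ab eqxx andbF.
Qed.

Lemma max_height (c : seq vertex) : (0 < size c)%N ->
  exists2 x, x \in c & forall y, y \in c -> (height y <= height x)%N.
Proof.
elim: c => // z [_ _|w c IH _].
  by exists z; rewrite ?mem_head // => y; rewrite inE => /eqP ->.
have [//|x xc xm] := IH; have [zx|xz] := leqP (height z) (height x).
  by exists x; [rewrite inE xc orbT | move=> y; rewrite inE => /predU1P[->|/xm]].
exists z; first exact: mem_head.
move=> y; rewrite inE => /predU1P[-> //|/xm yx].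
exact: leq_trans yx (ltnW xz).
Qed.

Lemma adj_acyclic c : (2 < size c)%N -> ~ ucycle adj c.
Proof.
move=> c2 /andP[cyc uc].
have [x xc xmax] := max_height (ltnW (ltnW c2)).
have [i [|z s] e] := rot_to xc.
  by have := size_rot i c; rewrite e => h; rewrite -h in c2.
have := cyc; rewrite -(rot_cycle i) e /= rcons_path => /andP[xz /andP[_ lx]].
have sz : (0 < size s)%N.
  by have := size_rot i c; rewrite e /= => h; move: c2; rewrite -h.
have up y : y \in c -> adj x y -> child y x.
  move=> yc /orP[/child_height h|//].
  by have := xmax y yc; rewrite h ltnn.
have ine y : y \in z :: s -> y \in c.
  by move=> ys; rewrite -(mem_rot i) e inE ys orbT.
have zx := up z (ine z (mem_head _ _)) xz.
have lc : last z s \in z :: s by exact: mem_last.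
have lx' : child (last z s) x by apply: up; rewrite ?ine // adj_sym.
have := uc; rewrite -(rot_uniq i) e /= => /and3P[_ + _].
rewrite (child_inj zx lx').
by case: s sz {e lx lc lx' ine} => // w s _ /=; rewrite mem_last.
Qed.

Lemma height_dist x :
  (exists2 s, path adj root s & last root s = x /\ size s = height x) /\
  (forall s, path adj root s -> last root s = x -> (height x <= size s)%N).
Proof.
split.
  have [n] := ubnP (height x); elim: n x => // n IH x hx.
  have [h0|/parent_exists[y yx]] := posnP (height x).
    exists [::] => //; split; last by rewrite h0.
    by apply: val_inj; rewrite /=; apply/esym/size0nil.
  have e := child_height yx.
  have [|s ps [ls ss]] := IH y; first by rewrite -ltnS -e.
  exists (rcons s x); first by rewrite rcons_path ps ls /adj yx.
  by rewrite last_rcons size_rcons ss e.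
move=> s; elim/last_ind: s x => [x _ <- //|s y IH x].
rewrite rcons_path last_rcons size_rcons => /andP[ps a] yx; subst y.
have h := IH _ ps erefl.
case/orP: a => /child_height e; first by rewrite e ltnS.
by apply: leq_trans (leqnSn _); apply: leq_trans h; rewrite e.
Qed.

Definition sphere (n : nat) := {x : vertex | height x == n}.
Definition ball (n : nat) := {x : vertex | (height x <= n)%N}.

HB.instance Definition _ n := SubType.on (sphere n).
HB.instance Definition _ n := Countable.on (sphere n).
HB.instance Definition _ n := SubType.on (ball n).
HB.instance Definition _ n := Countable.on (ball n).

Definition ball_code n (x : ball n) : {bseq n of 'I_k.+1} := Bseq (valP x).
Definition ball_decode n (s : {bseq n of 'I_k.+1}) : option (ball n) :=
  if (insub (val s) : option vertex) is Some x then insub x else None.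

Lemma ball_codeK n : pcancel (@ball_code n) (@ball_decode n).
Proof. by move=> x; rewrite /ball_decode /= !valK. Qed.

HB.instance Definition _ n :=
  fintype.isFinite.Build (ball n) (pcan_enumP (@ball_codeK n)).

Lemma sphere_le n (x : sphere n) : (height (val x) <= n)%N.
Proof. by rewrite (eqP (valP x)). Qed.

Definition sphere_ball n (x : sphere n) : ball n := Sub (val x) (sphere_le x).

Definition sphere_unball n (x : ball n) : option (sphere n) := insub (val x).

Lemma sphere_ballK n : pcancel (@sphere_ball n) (@sphere_unball n).
Proof. by move=> x; rewrite /sphere_unball /= valK. Qed.

HB.instance Definition _ n :=
  fintype.isFinite.Build (sphere n) (pcan_enumP (@sphere_ballK n)).

End CayleyTree.

Section Configurations.
Variables k q : nat.

Definition config := vertex k -> 'I_q.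
Definition ball_config (n : nat) := {ffun ball k n -> 'I_q}.
Definition sphere_config (n : nat) := {ffun sphere k n -> 'I_q}.

Definition restrict (n : nat) (s : config) : ball_config n :=
  [ffun x => s (val x)].

Lemma ball_shell n (x : ball k n.+1) :
  ~ (height (val x) <= n)%N -> height (val x) == n.+1.
Proof. by move=> /negP h; rewrite eqn_leq (valP x) ltnNge h. Qed.

Definition join (n : nat) (s : ball_config n) (w : sphere_config n.+1) :
    ball_config n.+1 :=
  [ffun x => match decP (@idP (height (val x) <= n)%N) with
             | left le => s (Sub (val x) le)
             | right gt => w (Sub (val x) (ball_shell gt))
             end].

Lemma join_ball n (s : ball_config n) w (x : ball k n.+1) (y : ball k n) :
  val x = val y -> join s w x = s y.
Proof.
move=> e; rewrite ffunE; case: decP => h.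
  by congr (s _); apply: val_inj.
by case: (h); rewrite e (valP y).
Qed.

Lemma join_sphere n s (w : sphere_config n.+1) (x : ball k n.+1)
    (y : sphere k n.+1) : val x = val y -> join s w x = w y.
Proof.
move=> e; rewrite ffunE; case: decP => h.
  by exfalso; move: h; rewrite e (eqP (valP y)) ltnn.
by congr (w _); apply: val_inj.
Qed.

Definition cylinder (n : nat) (B : {set ball_config n}) : set config :=
  [set s | restrict n s \in B].

Definition cylinders : set (set config) :=
  [set A | exists n (B : {set ball_config n}), A = cylinder B].

End Configurations.

Arguments cylinders k q : clear implicits.

Section Gibbs.
Variables (R : realType) (p : nat) (K : padicField R p) (k q : nat).

(* A set function is defined on the algebra of cylinder sets only, so that two
   measures are equal iff they agree on all cylinder sets. *)
Definition finitely_additive (mu : cylinders k q -> K) : Prop :=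
  forall A B C : cylinders k q,
    val A `&` val B = set0 -> val C = val A `|` val B -> mu C = mu A + mu B.

Definition padic_probability (mu : cylinders k q -> K) : Prop :=
  finitely_additive mu /\ (forall A, val A = setT -> mu A = 1).

(* Every edge of the ball occurs exactly once, oriented away from the root. *)
Definition hamiltonian (J : K) (n : nat) (s : ball_config k q n) : K :=
  J * \sum_(x : ball k n) \sum_(y : ball k n | child (val x) (val y))
        (s x == s y)%:R.

Section Field.
Variables (J : K) (h : vertex k -> 'I_q -> K).

Definition gibbs_weight (n : nat) (s : ball_config k q n) : K :=
  padic_exp (hamiltonian J s +
             \sum_(x : sphere k n) h (val x) (s (sphere_ball x))).

Definition partition_fun (n : nat) : K :=
  \sum_(s : ball_config k q n) gibbs_weight s.

Definition finite_gibbs (n : nat) (s : ball_config k q n) : K :=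
  (partition_fun n)^-1 * gibbs_weight s.

Definition compatible : Prop :=
  forall (n : nat) (s : ball_config k q n),
    \sum_(w : sphere_config k q n.+1) finite_gibbs (join s w) = finite_gibbs s.

End Field.

Definition gibbs_measures (J : K) : set (cylinders k q -> K) :=
  [set mu | exists h : vertex k -> 'I_q -> K,
     [/\ forall x i, exp_domain (h x i),
         forall n, partition_fun J h n != 0,
         compatible J h,
         padic_probability mu &
         forall n (s : ball_config k q n) (A : cylinders k q),
           val A = cylinder [set s]%SET -> mu A = finite_gibbs J h s]].

End Gibbs.

Arguments gibbs_measures {R p} K k q J.

(* Main.v *)
(* Put a = theta - 1 = q/2. A boundary law equal to z = x^3 on a set M of m spins and to 1 on the
   other spins is reproduced by three children iff
     (x - 1)^2 (m x^2 + (m - a) x + m - 2a) = 0,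
   so at this critical theta only a quadratic is left. By Hensel's lemma it has a root x near 1
   under (a), (b), (c) and near a primitive cube root of unity under (d). In all cases x^3 <> 1 is
   so close to 1 that it is the exponential of some element.
   The root of the tree has four children, so a translation-invariant law would ask for x^4, which
   under (d) is not a value of the exponential. The law is therefore taken trivial on one of the
   four branches at the root, and then every vertex collects x^3 only. The measures obtained from
   the sets M, and the one with the trivial law, differ in the distribution of the spin at the
   root. *)
Require Import Defs.
From mathcomp Require Import all_boot all_order all_algebra.
From mathcomp Require Import all_classical all_reals all_analysis.
From mathcomp Require Import ring lra zify.

(* Again, so that [ball], [child] and [root] refer to the Cayley tree. *)
Import Defs.
Import Order.TTheory GRing.Theory Num.Theory.
Import numFieldNormedType.Exports.
Local Open Scope classical_set_scope.
Local Open Scope ring_scope.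
Local Open Scope card_scope.

Set Implicit Arguments.
Unset Strict Implicit.
Unset Printing Implicit Defensive.

(** * The p-adic norm *)

Section PadicNorm.
Variables (R : realType) (p : nat) (p_prime : prime p) (K : padicField R p).
Implicit Types x y z : K.

Local Notation N := (@padic_norm R p K).

Lemma padic_norm_nat (n : nat) : (0 < n)%N ->
  N n%:R = (p%:R ^+ logn p n)^-1.
Proof.
move=> n0; rewrite -[n%:R](ratr_nat K) padic_norm_rat /padic_abs_rat.
rewrite pnatr_eq0 eqn0Ngt n0 /=.
have -> : numq n%:R = n by rewrite -[n%:R]/(n%:~R) numq_int.
have -> : denq n%:R = 1 by rewrite -[n%:R]/(n%:~R) denq_int.
by rewrite /= logn1 expr0 div1r.
Qed.

Lemma padic_norm0 : N 0 = 0.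
Proof. by have := padic_norm_rat K 0; rewrite (ratr_nat K 0) /padic_abs_rat eqxx. Qed.

Lemma padic_norm1 : N 1 = 1.
Proof. by rewrite -[1]/(1%:R) padic_norm_nat // logn1 expr0 invr1. Qed.

Lemma padic_normX x n : N (x ^+ n) = N x ^+ n.
Proof.
elim: n => [|n IH]; first by rewrite !expr0 padic_norm1.
by rewrite !exprS padic_normM IH.
Qed.

Lemma padic_normN x : N (- x) = N x.
Proof.
have h : N (-1) = 1.
  apply/eqP; rewrite -(@eqrXn2 _ 2) ?padic_norm_ge0 // -padic_normX sqrrN expr1n.
  by rewrite padic_norm1 expr1n.
by rewrite -mulN1r padic_normM h mul1r.
Qed.

Lemma padic_norm_eq0E x : (N x == 0) = (x == 0).
Proof.
by apply/eqP/eqP => [/padic_norm_eq0 //|->]; rewrite padic_norm0.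
Qed.

Lemma padic_norm_gt0 x : (0 < N x) = (x != 0).
Proof. by rewrite lt_def padic_norm_ge0 andbT padic_norm_eq0E. Qed.

Lemma padic_normV x : N x^-1 = (N x)^-1.
Proof.
have [->|x0] := eqVneq x 0; first by rewrite invr0 padic_norm0 invr0.
apply: (mulfI (x := N x)); first by rewrite padic_norm_eq0E.
by rewrite -padic_normM !divff ?padic_norm1 // padic_norm_eq0E.
Qed.

Lemma padic_norm_div x y : N (x / y) = N x / N y.
Proof. by rewrite padic_normM padic_normV. Qed.

Lemma padic_normD_le x y (e : R) : N x <= e -> N y <= e -> N (x + y) <= e.
Proof.
by move=> hx hy; apply: le_trans (padic_normD _ _) _; rewrite ge_max hx.
Qed.

Lemma padic_normB_le x y (e : R) : N x <= e -> N y <= e -> N (x - y) <= e.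
Proof. by move=> hx hy; apply: padic_normD_le => //; rewrite padic_normN. Qed.

Lemma padic_normD_lt x y (e : R) : N x < e -> N y < e -> N (x + y) < e.
Proof.
by move=> hx hy; apply: le_lt_trans (padic_normD _ _) _; rewrite gt_max hx.
Qed.

Lemma padic_normB_lt x y (e : R) : N x < e -> N y < e -> N (x - y) < e.
Proof. by move=> hx hy; apply: padic_normD_lt => //; rewrite padic_normN. Qed.

Lemma padic_norm_sum_le I (r : seq I) (P : pred I) (F : I -> K) (e : R) :
  0 <= e -> (forall i, P i -> N (F i) <= e) -> N (\sum_(i <- r | P i) F i) <= e.
Proof.
move=> e0 h; elim/big_ind: _ => // [|x y hx hy]; first by rewrite padic_norm0.
exact: padic_normD_le.
Qed.

(** Isosceles triangles: if the sum had norm below [N x], then [x] would be a difference of two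
    elements of norm below [N x]. *)
Lemma padic_normD_eq x y : N y < N x -> N (x + y) = N x.
Proof.
move=> h; apply/le_anti; rewrite padic_normD_le ?(ltW h) //= leNgt.
apply/negP => h2; suff : N x < N x by rewrite ltxx.
by have := padic_normB_lt h2 h; rewrite addrK.
Qed.

Lemma padic_norm_nat_le1 n : N n%:R <= 1.
Proof.
rewrite -[n]card_ord -sumr_const; apply: padic_norm_sum_le => // i _.
by rewrite padic_norm1.
Qed.

Lemma p_gt1 : 1 < p%:R :> R.
Proof. by rewrite ltr1n prime_gt1. Qed.

Lemma p_gt0 : 0 < p%:R :> R.
Proof. exact: lt_trans ltr01 p_gt1. Qed.

Lemma padic_natr_neq0 n : (0 < n)%N -> n%:R != 0 :> K.
Proof.
move=> n0; rewrite -padic_norm_eq0E padic_norm_nat // invr_eq0 expf_eq0.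
by rewrite gt_eqF ?andbF // p_gt0.
Qed.

Lemma padic_norm_coprime n : (0 < n)%N -> ~~ (p %| n)%N -> N n%:R = 1.
Proof.
move=> n0 h; rewrite padic_norm_nat //.
suff -> : logn p n = 0%N by rewrite expr0 invr1.
by apply/eqP; move: h; apply: contraNT; rewrite -lt0n logn_gt0 mem_primes => /and3P[].
Qed.

Lemma padic_norm_p : N p%:R = p%:R^-1.
Proof. by rewrite padic_norm_nat ?prime_gt0 // logn_prime // eqxx expr1. Qed.

(** A rational closer to [x] than [N x] has the same norm as [x], so the value group is that of the
    rationals. Two natural exponents replace one integer exponent. *)
Lemma padic_norm_value x : x != 0 ->
  exists a b : nat, N x * p%:R ^+ a = p%:R ^+ b.
Proof.
rewrite -padic_norm_gt0 => x0; have [r hr] := padic_rat_dense x x0.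
have e : N (ratr r) = N x.
  have -> : ratr r = x - (x - ratr r) by rewrite opprB addrC subrK.
  by rewrite padic_normD_eq ?padic_normN.
have r0 : r != 0.
  by apply/eqP => r0; move: x0; rewrite -e r0 (ratr_nat K 0) padic_norm0 ltxx.
exists (logn p `|numq r|%N), (logn p `|denq r|%N).
rewrite -e padic_norm_rat /padic_abs_rat (negPf r0) divfK //.
by rewrite expf_eq0 gt_eqF ?andbF // p_gt0.
Qed.

(** The value group is discrete: no norm lies strictly between 1/p and 1. *)
Lemma padic_norm_lt1 x : N x < 1 -> N x <= p%:R^-1.
Proof.
move=> x1; have [->|x0] := eqVneq x 0; first by rewrite padic_norm0 invr_ge0 ler0n.
have [a [b e]] := padic_norm_value x0.
have pa n : 0 < p%:R ^+ n :> R by rewrite exprn_gt0 // p_gt0.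
have : (b < a)%N.
  rewrite -(ltr_eXn2l (x := p%:R : R)) ?p_gt1 // -e -[ltRHS]mul1r.
  by rewrite ltr_pM2r.
move=> ba; rewrite -(ler_pM2r (pa a)) e -[a]prednK ?(leq_ltn_trans _ ba) //.
rewrite exprS mulKf ?gt_eqF ?p_gt0 // ler_eXn2l ?p_gt1 //.
by case: a ba {e}.
Qed.

End PadicNorm.

(** * Limits and fixed points in Q_p *)

Section PadicAnalysis.
Variables (R : realType) (p : nat) (K : padicField R p).
Implicit Types x y z : K.

Local Notation N := (@padic_norm R p K).

Definition padic_cvg (u : nat -> K) (l : K) :=
  forall e : R, 0 < e -> exists n0, forall n, (n0 <= n)%N -> N (u n - l) < e.

Lemma padic_cvgP u l :
  (N (u n - l) @[n --> \oo] --> (0 : R)) <-> padic_cvg u l.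
Proof.
split=> [/cvgrPdist_lt h e e0|h].
  have [n0 _ hn] := h _ e0; exists n0 => n /hn /=.
  by rewrite sub0r normrN ger0_norm // padic_norm_ge0.
apply/cvgrPdist_lt => e /h[n0 hn]; exists n0 => // n /hn /=.
by rewrite sub0r normrN ger0_norm // padic_norm_ge0.
Qed.

Lemma padic_cvg_unique u l l' : padic_cvg u l -> padic_cvg u l' -> l = l'.
Proof.
move=> h h'; apply/eqP; rewrite -subr_eq0 -padic_norm_eq0E.
apply/eqP/le_anti; rewrite padic_norm_ge0 andbT leNgt; apply/negP => e0.
have [n hn] := h _ e0; have [n' hn'] := h' _ e0.
have := padic_normB_lt (hn' _ (leq_maxr n n')) (hn _ (leq_maxl n n')).
by rewrite opprB addrC addrA subrK ltxx.
Qed.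

Lemma padic_cvg_norm_le u l (r : R) :
  padic_cvg u l -> (forall n, N (u n) <= r) -> N l <= r.
Proof.
move=> h hr; rewrite leNgt; apply/negP => rl.
have l0 : 0 < N l.
  by apply: le_lt_trans rl; apply: le_trans (hr 0%N); rewrite padic_norm_ge0.
have [n hn] := h _ l0.
have := padic_normB_lt (le_lt_trans (hr n) rl) (hn n (leqnn n)).
by rewrite opprB addrC subrK ltxx.
Qed.

Lemma padic_cvg_geometric u l (c : R) (a : R) : 0 <= c < 1 ->
  (forall n, N (u n - l) <= a * c ^+ n) -> padic_cvg u l.
Proof.
move=> /andP[c0 c1] h; apply/padic_cvgP.
apply: (@squeeze_cvgr _ _ _ _ (fun=> 0) (geometric a c)).
- by near=> n; rewrite padic_norm_ge0 h.
- exact: cvg_cst.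
- by apply: cvg_geometric; rewrite ger0_norm.
Unshelve. all: end_near. Qed.

Lemma padic_cvg_cauchy_geometric u (a c : R) : 0 <= c < 1 ->
  (forall n, N (u n.+1 - u n) <= a * c ^+ n) -> exists l, padic_cvg u l.
Proof.
move=> /andP[c0 c1] h.
have a0 : 0 <= a.
  by have := h 0%N; rewrite expr0 mulr1; apply: le_trans; apply: padic_norm_ge0.
(* By the ultrametric inequality a tail is bounded by its largest increment, so no geometric series
   has to be summed. *)
have H n k : N (u (n + k)%N - u n) <= a * c ^+ n.
  elim: k => [|k IH].
    by rewrite addn0 subrr padic_norm0 // mulr_ge0 // exprn_ge0.
  rewrite -[u _](subrK (u (n + k)%N)) -addrA addnS padic_normD_le //.
  apply: le_trans (h _) _; rewrite ler_wpM2l //.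
  by rewrite ler_wiXn2l ?leq_addr // ltW.
have [l hl] : exists l, N (u n - l) @[n --> \oo] --> (0 : R).
  apply: padic_complete => e e0.
  have /cvgrPdist_lt/(_ _ e0)[n0 _ hn] : geometric a c @ \oo --> (0 : R).
    by apply: cvg_geometric; rewrite ger0_norm.
  have {}hn : a * c ^+ n0 < e.
    have := hn n0 (leqnn n0).
    by rewrite /= sub0r normrN ger0_norm // mulr_ge0 // exprn_ge0.
  exists n0 => i j /subnKC <- /subnKC <-.
  have := padic_normB_le (H n0 (i - n0)%N) (H n0 (j - n0)%N).
  by rewrite opprB addrA subrK => h2; apply: le_lt_trans h2 hn.
by exists l; apply/padic_cvgP.
Qed.

(** Banach's fixed point theorem on a closed ball about 0, by iterating [G] from 0. It gives both
    Hensel's lemma and a local inverse of the exponential. *)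
Lemma padic_contraction (r c : R) (G : K -> K) : 0 <= r -> 0 <= c < 1 ->
  (forall x, N x <= r -> N (G x) <= r) ->
  (forall x y, N x <= r -> N y <= r -> N (G x - G y) <= c * N (x - y)) ->
  exists2 x, N x <= r & G x = x.
Proof.
move=> r0 c01 Gr Gc; have /andP[c0 c1] := c01.
pose u n := iter n G 0.
have ur n : N (u n) <= r by elim: n => [|n IH]; rewrite ?padic_norm0 ?Gr.
have [l ul] : exists l, padic_cvg u l.
  apply: (@padic_cvg_cauchy_geometric _ r c) => //; elim=> [|n IH].
    by rewrite expr0 mulr1 subr0 ur.
  apply: (le_trans (Gc (u n.+1) (u n) (ur _) (ur _))).
  by rewrite exprS mulrCA ler_wpM2l.
have lr := padic_cvg_norm_le ul ur.
exists l => //; apply: (@padic_cvg_unique (fun n => u n.+1)) => e /ul[n0 hn].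
  exists n0 => n /hn h; apply: le_lt_trans h.
  apply: (le_trans (Gc (u n) l (ur _) lr)).
  by rewrite ler_piMl ?padic_norm_ge0 // ltW.
by exists n0 => n nn; apply: hn; apply: leqW.
Qed.

(* Hensel: the fixed points of y |-> - (y^2 + c) / b. *)
Lemma padic_quadratic_root (b c : K) : N c < N b ^+ 2 ->
  exists2 y, y ^+ 2 + b * y + c = 0 & N y <= N c / N b.
Proof.
move=> cb.
have b0 : 0 < N b.
  rewrite lt_def padic_norm_ge0 andbT; apply: contraTneq cb => ->.
  by rewrite expr0n /= ltNge padic_norm_ge0.
have bn0 : b != 0 by rewrite -padic_norm_gt0.
(* The hypothesis says exactly that [r < N b], so [r / N b] is a Lipschitz constant below 1 on the
   ball of radius [r]. *)
set r := N c / N b.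
have r0 : 0 <= r by rewrite divr_ge0 ?padic_norm_ge0.
have rb : r < N b by rewrite ltr_pdivrMr // -expr2.
have rb01 : 0 <= r / N b < 1.
  by rewrite divr_ge0 ?(ltW b0) //= ltr_pdivrMr // mul1r.
have [x xr|x y xr yr|y yr e] :=
    @padic_contraction r (r / N b) (fun y => - (y ^+ 2 + c) / b) r0 rb01.
- rewrite padic_norm_div // padic_normN // ler_pM2r ?invr_gt0 //.
  apply: padic_normD_le => //; rewrite padic_normX //.
  rewrite -[leRHS](divfK (lt0r_neq0 b0)) -/r expr2.
  by rewrite ler_pM ?padic_norm_ge0 // (le_trans xr) // ltW.
- have -> : - (x ^+ 2 + c) / b - - (y ^+ 2 + c) / b = - (x + y) / b * (x - y).
    by field.
  rewrite padic_normM ler_wpM2r ?padic_norm_ge0 // padic_norm_div // padic_normN //.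
  by rewrite ler_pM2r ?invr_gt0 // padic_normD_le.
- by exists y => //; rewrite -{2}e; field.
Qed.

End PadicAnalysis.

(** * The p-adic exponential *)

Lemma logn_fact_le (p n : nat) : prime p -> (0 < n)%N ->
  (p.-1 * logn p n`! <= n.-1)%N.
Proof.
move=> pp n0; have p1 := prime_gt1 pp.
(* Invariant for the partial sums in Legendre's formula: [n %/ p ^ k] is the part of [n] still to be
   spent, and the maximum with 1 leaves the final [n.-1]. *)
suff H k : (p.-1 * (\sum_(1 <= i < k.+1) n %/ p ^ i) + maxn 1 (n %/ p ^ k) <= n)%N.
  by rewrite logn_fact //; have := H n; lia.
elim: k => [|k IH]; first by rewrite big_geq // muln0 expn0 divn1; lia.
rewrite big_nat_recr //= mulnDr; apply: leq_trans IH.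
rewrite -addnA leq_add2l expnSr divnMA.
set t := (n %/ p ^ k)%N; have := leq_trunc_div t p; set s := (t %/ p)%N => h.
suff : (p.-1 * s + s <= t)%N by nia.
by rewrite -mulSnr prednK ?(ltnW p1) // mulnC.
Qed.

Section PadicExp.
Variables (R : realType) (p : nat) (p_prime : prime p) (K : padicField R p).
Implicit Types x y z : K.

Local Notation N := (@padic_norm R p K).

Definition exp_radius : R := p%:R `^ (- (p.-1%:R)^-1).
Local Notation rho := exp_radius.

Lemma exp_radius_gt0 : 0 < rho.
Proof. by rewrite powR_gt0 // p_gt0. Qed.

(** Besides positivity, this identity is all that is used of the real power defining [rho]. *)
Lemma exp_radiusX : rho ^+ p.-1 = p%:R^-1.
Proof.
rewrite -powR_mulrn ?ltW ?exp_radius_gt0 // /rho -powRrM mulNr mulVf.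
  by rewrite powR_inv1.
by rewrite pnatr_eq0; have := prime_gt1 p_prime; lia.
Qed.

Lemma exp_radius_lt1 : rho < 1.
Proof.
rewrite ltNge; apply/negP => h; have := exprn_ege1 p.-1 h.
by rewrite exp_radiusX invf_ge1 ?p_gt0 // leNgt p_gt1.
Qed.

(** For odd p, together with [padic_norm_lt1], this puts every element of norm below 1 within the
    radius. For p = 2 the radius is 1/2 itself. *)
Lemma exp_radius_gt_pinv : (2 < p)%N -> p%:R^-1 < rho.
Proof.
move=> p2; rewrite -exp_radiusX -[ltRHS]expr1.
by rewrite ltr_iXn2l ?exp_radius_gt0 ?exp_radius_lt1 //; lia.
Qed.

Lemma padic_norm_fact_ge n : rho ^+ n.-1 <= N n`!%:R.
Proof.
rewrite padic_norm_nat ?fact_gt0 // -exprVn -exp_radiusX -exprM.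
have [->|n0] := posnP n; first by rewrite fact0 logn1 muln0 !expr0.
by rewrite ler_wiXn2l ?(ltW exp_radius_gt0) ?(ltW exp_radius_lt1) // logn_fact_le.
Qed.

Definition exp_term x n : K := x ^+ n / n`!%:R.

Lemma exp_sumsS x n : exp_sums x n.+1 = exp_sums x n + exp_term x n.
Proof. by rewrite /exp_sums big_ord_recr. Qed.

(** The factorial of [n.+1] costs only [n] powers of [rho], so one factor [N x] stays outside. This
    is what bounds exp x - 1 by [N x]. *)
Lemma exp_term_le x n : N (exp_term x n.+1) <= N x * (N x / rho) ^+ n.
Proof.
rewrite padic_norm_div padic_normX exprS -mulrA ler_wpM2l ?padic_norm_ge0 //.
rewrite expr_div_n ler_wpM2l ?exprn_ge0 ?padic_norm_ge0 //.
rewrite lef_pV2 ?posrE ?padic_norm_gt0 ?exprn_gt0 ?exp_radius_gt0 //.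
  exact: (padic_norm_fact_ge n.+1).
by rewrite padic_natr_neq0 // fact_gt0.
Qed.

Lemma exp_term_geometric x n : N x < rho -> N (exp_term x n) <= (N x / rho) ^+ n.
Proof.
move=> xr; case: n => [|n].
  by rewrite /exp_term fact0 divr1 !expr0 padic_norm1.
apply: le_trans (exp_term_le _ _) _; rewrite exprS ler_wpM2r //.
  by rewrite exprn_ge0 // divr_ge0 ?padic_norm_ge0 // ltW // exp_radius_gt0.
rewrite ler_pdivlMr ?exp_radius_gt0 // ler_piMr ?padic_norm_ge0 //.
exact: ltW exp_radius_lt1.
Qed.

Lemma exp_ratio x : N x < rho -> 0 <= N x / rho < 1.
Proof.
move=> xr; rewrite divr_ge0 ?padic_norm_ge0 ?(ltW exp_radius_gt0) //=.
by rewrite ltr_pdivrMr ?exp_radius_gt0 // mul1r.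
Qed.

Lemma exp_sums_cvg x : N x < rho -> padic_cvg (exp_sums x) (padic_exp x).
Proof.
move=> xr; have [l hl] : exists l, padic_cvg (exp_sums x) l.
  apply: (@padic_cvg_cauchy_geometric _ _ _ _ 1 (N x / rho)).
    exact: exp_ratio.
  by move=> n; rewrite exp_sumsS addrAC subrr add0r mul1r exp_term_geometric.
apply/padic_cvgP; apply: (@xgetPex _ 0 (exp_lims x)); exists l.
exact/padic_cvgP.
Qed.

Lemma exp_domain_lt x : N x < rho -> exp_domain x.
Proof. by move=> xr; exists (padic_exp x); apply/padic_cvgP/exp_sums_cvg. Qed.

Lemma exp_sums_norm_le x n : N x < rho -> N (exp_sums x n) <= 1.
Proof.
move=> xr; apply: padic_norm_sum_le => // i _.
apply: le_trans (exp_term_geometric i xr) _.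
by have /andP[? ?] := exp_ratio xr; rewrite exprn_ile1 // ltW.
Qed.

Lemma padic_exp_norm_le x : N x < rho -> N (padic_exp x) <= 1.
Proof.
move=> xr; apply: padic_cvg_norm_le (exp_sums_cvg xr) _ => n.
exact: exp_sums_norm_le.
Qed.

Lemma exp_sums_tail x n m : N x < rho ->
  N (exp_sums x (n.+1 + m)%N - exp_sums x n.+1) <= N x * (N x / rho) ^+ n.
Proof.
move=> xr; have /andP[c0 c1] := exp_ratio xr.
elim: m => [|m IH].
  by rewrite addn0 subrr padic_norm0 mulr_ge0 ?padic_norm_ge0 // exprn_ge0.
rewrite addnS exp_sumsS addrAC padic_normD_le //.
apply: le_trans (exp_term_le _ _) _; rewrite ler_wpM2l ?padic_norm_ge0 //.
by rewrite ler_wiXn2l ?(ltW c1) // leq_addr.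
Qed.

(** The truncation error obeys the bound for the first omitted term. The cases n = 0 and n = 1 are
    the first and second order estimates that follow. *)
Lemma padic_exp_tail x n : N x < rho ->
  N (padic_exp x - exp_sums x n.+1) <= N x * (N x / rho) ^+ n.
Proof.
move=> xr.
apply: (@padic_cvg_norm_le _ _ _ (fun m => exp_sums x (n.+1 + m)%N - exp_sums x n.+1)).
  move=> e /(exp_sums_cvg xr)[n0 h]; exists n0 => k k0.
  by rewrite opprB addrA subrK h // (leq_trans k0) // leq_addl.
by move=> m; apply: exp_sums_tail.
Qed.

Lemma padic_exp_sub1 x : N x < rho -> N (padic_exp x - 1) <= N x.
Proof.
move=> xr; have := padic_exp_tail 0 xr.
by rewrite exp_sumsS /exp_sums big_ord0 add0r /exp_term fact0 divr1 !expr0 mulr1.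
Qed.

Lemma padic_exp_sub1x x : N x < rho ->
  N (padic_exp x - 1 - x) <= N x * (N x / rho).
Proof.
move=> xr; have := padic_exp_tail 1 xr.
rewrite !exp_sumsS /exp_sums big_ord0 add0r /exp_term fact0 divr1 expr0 divr1.
by rewrite !expr1 opprD addrA.
Qed.

(** Both sides run over the triangle i + j < n, the left one along its antidiagonals. *)
Lemma cauchy_product (a b : nat -> K) n :
  \sum_(k < n) \sum_(i < k.+1) a i * b (k - i)%N =
  \sum_(i < n) \sum_(j < n | (i + j < n)%N) a i * b j.
Proof.
transitivity (\sum_(k < n) \sum_(i < n | (i < k.+1)%N) a i * b (k - i)%N).
  apply: eq_bigr => k _.
  by rewrite (big_ord_widen n (fun i => a i * b (k - i)%N)).
rewrite (exchange_big_dep xpredT) //=; apply: eq_bigr => i _.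
transitivity (\sum_(i <= k < n) a i * b (k - i)%N).
  by rewrite big_geq_mkord /=.
rewrite -{1}[i : nat]add0n big_addn big_mkord.
rewrite (big_ord_widen n (fun k => a i * b (k + i - i)%N)) ?leq_subr //.
by apply: eq_big => [j|j _]; rewrite ?addnK // ltn_subRL.
Qed.

Lemma exp_term_binomial x y n :
  exp_term (x + y) n = \sum_(i < n.+1) exp_term x i * exp_term y (n - i)%N.
Proof.
rewrite /exp_term addrC exprDn mulr_suml; apply: eq_bigr => i _.
have hi : (i <= n)%N by rewrite -ltnS.
have := bin_fact hi => /(congr1 (fun k => k%:R : K)); rewrite !natrM => e.
have f0 k : (k`!)%:R != 0 :> K by rewrite padic_natr_neq0 // fact_gt0.
rewrite -e -mulr_natr; move: e (f0 i) (f0 (n - i)%N) (f0 n) => <-.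
by rewrite !mulf_eq0 !negb_or => ? ? /and3P[? _ _]; field; apply/and3P.
Qed.

(** The n-th partial sum at [x + y] differs from the product of the n-th partial sums by the terms
    of the square with i + j >= n, each of norm at most [c ^+ n]. *)
Lemma padic_expD x y : N x < rho -> N y < rho ->
  padic_exp (x + y) = padic_exp x * padic_exp y.
Proof.
move=> xr yr; have xyr := padic_normD_lt xr yr.
apply: padic_cvg_unique (exp_sums_cvg xyr) _.
set c := Num.max (N x / rho) (N y / rho).
have c01 : 0 <= c < 1.
  have /andP[? ?] := exp_ratio xr; have /andP[? ?] := exp_ratio yr.
  by rewrite le_max gt_max; apply/andP; split; [apply/orP; left|apply/andP].
have /andP[c0 c1] := c01.
have diff n : N (exp_sums (x + y) n - exp_sums x n * exp_sums y n - 0) <= 1 * c ^+ n.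
  have -> : exp_sums (x + y) n =
      \sum_(i < n) \sum_(j < n | (i + j < n)%N) exp_term x i * exp_term y j.
    rewrite -cauchy_product; apply: eq_bigr => k _; exact: exp_term_binomial.
  rewrite subr0 mul1r /exp_sums big_distrlr /= -sumrB padic_norm_sum_le ?exprn_ge0 //.
  move=> i _; rewrite [X in _ - X](bigID (fun j : 'I_n => (i + j < n)%N)) /=.
  rewrite opprD addrA subrr sub0r padic_normN padic_norm_sum_le ?exprn_ge0 //.
  move=> j; rewrite -leqNgt padic_normM => ij.
  apply: le_trans (_ : c ^+ i * c ^+ j <= _).
    rewrite ler_pM ?padic_norm_ge0 //.
      apply: le_trans (exp_term_geometric i xr) _.
      have /andP[? ?] := exp_ratio xr.
      by rewrite lerXn2r ?nnegrE // le_max lexx.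
    apply: le_trans (exp_term_geometric j yr) _.
    have /andP[? ?] := exp_ratio yr.
    by rewrite lerXn2r ?nnegrE // le_max lexx orbT.
  by rewrite -exprD ler_wiXn2l // ltW.
move=> e e0; have [n1 h1] := padic_cvg_geometric c01 diff e0.
have [n2 h2] := exp_sums_cvg xr e0; have [n3 h3] := exp_sums_cvg yr e0.
exists (maxn n1 (maxn n2 n3)) => n; rewrite !geq_max => /and3P[n1n n2n n3n].
have := h1 _ n1n; rewrite subr0 => {}h1.
rewrite -[exp_sums _ _](subrK (exp_sums x n * exp_sums y n)) -addrA.
apply: padic_normD_lt => //.
have -> : exp_sums x n * exp_sums y n - padic_exp x * padic_exp y =
  (exp_sums x n - padic_exp x) * exp_sums y n
   + padic_exp x * (exp_sums y n - padic_exp y) by ring.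
apply: padic_normD_lt; rewrite padic_normM.
  apply: le_lt_trans (h2 _ n2n).
  by rewrite ler_piMr ?padic_norm_ge0 // exp_sums_norm_le.
apply: le_lt_trans (h3 _ n3n).
by rewrite ler_piMl ?padic_norm_ge0 // padic_exp_norm_le.
Qed.

Lemma padic_exp0 : padic_exp (0 : K) = 1.
Proof.
apply/eqP; rewrite -subr_eq0 -padic_norm_eq0E eq_le padic_norm_ge0 andbT.
have h : N 0 < rho by rewrite padic_norm0 exp_radius_gt0.
by rewrite (le_trans (padic_exp_sub1 h)) // padic_norm0.
Qed.

(** The norm bound is carried along because every use of [padic_expD] in the induction needs the
    partial sum within the radius. *)
Lemma padic_exp_sum I (r : seq I) (P : pred I) (F : I -> K) :
  (forall i, P i -> N (F i) < rho) ->
  N (\sum_(i <- r | P i) F i) < rho /\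
  padic_exp (\sum_(i <- r | P i) F i) = \prod_(i <- r | P i) padic_exp (F i).
Proof.
move=> h; elim/big_rec2: _ => [|i v u Pi [ur <-]].
  by rewrite padic_norm0 exp_radius_gt0 padic_exp0.
have Fr := h i Pi.
rewrite -padic_expD //; split=> //; exact: padic_normD_lt.
Qed.

(* The logarithm is replaced by the fixed point of x |-> x - exp x + z. *)
Lemma padic_exp_onto z : N (z - 1) < rho ->
  exists2 x, N x < rho & padic_exp x = z.
Proof.
move=> zr; set r := N (z - 1).
have r0 : 0 <= r := padic_norm_ge0 _.
have c01 := exp_ratio zr; have /andP[c0 c1] := c01.
have lip x y : N x <= r -> N y <= r ->
    N (x - padic_exp x - (y - padic_exp y)) <= r / rho * N (x - y).
  move=> xr yr; have yr' := le_lt_trans yr zr.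
  set d := x - y; have dr : N d <= r by exact: padic_normB_le.
  (* Writing x = y + d splits the increment into the second order error at [d] and a multiple of [d]
     by the small exp y - 1. *)
  have -> : x - padic_exp x - (y - padic_exp y) =
      - (padic_exp y * (padic_exp d - 1 - d) + (padic_exp y - 1) * d).
    have -> : padic_exp x = padic_exp y * padic_exp d.
      by rewrite -padic_expD ?(le_lt_trans dr) // /d addrC subrK.
    by rewrite /d; ring.
  rewrite padic_normN; apply: padic_normD_le; rewrite padic_normM.
    apply: le_trans (_ : N (padic_exp d - 1 - d) <= _).
      by rewrite ler_piMl ?padic_norm_ge0 // padic_exp_norm_le.
    apply: le_trans (padic_exp_sub1x (le_lt_trans dr zr)) _.
    rewrite mulrC ler_wpM2r ?padic_norm_ge0 //.
    by rewrite ler_pM2r ?invr_gt0 ?exp_radius_gt0.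
  rewrite ler_wpM2r ?padic_norm_ge0 //.
  apply: le_trans (padic_exp_sub1 yr') _; apply: le_trans yr _.
  rewrite ler_pdivlMr ?exp_radius_gt0 // ler_piMr //.
  exact: ltW exp_radius_lt1.
have [x xr|x y xr yr|x xr e] :=
    @padic_contraction _ _ _ r (r / rho) (fun x => x - padic_exp x + z) r0 c01.
- have -> : x - padic_exp x + z = (x - (padic_exp x - 1)) + (z - 1) by ring.
  apply: padic_normD_le => //; apply: padic_normB_le => //.
  exact: le_trans (padic_exp_sub1 (le_lt_trans xr zr)) xr.
- by rewrite opprD addrACA subrr addr0; apply: lip.
exists x; first exact: le_lt_trans xr zr.
apply/esym/eqP; rewrite -subr_eq0 -[X in _ == X](subrr x) -[X in _ == X - _]e.
by apply/eqP; ring.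
Qed.

End PadicExp.

(** * The root of the critical quadratic *)

(** The polynomial X^2 + X + 1 has no root modulo 2, so this form is anisotropic there. *)
Lemma dvdz2_norm_form (n d : int) : (2 %| n ^+ 2 + n * d + d ^+ 2)%Z ->
  (2 %| n)%Z /\ (2 %| d)%Z.
Proof.
move=> /dvdzP[k]; rewrite (divz_eq n 2) (divz_eq d 2).
have [n0 n1] : (0 <= n %% 2)%Z /\ (n %% 2 < 2)%Z by rewrite modz_ge0 // ltz_pmod.
have [d0 d1] : (0 <= d %% 2)%Z /\ (d %% 2 < 2)%Z by rewrite modz_ge0 // ltz_pmod.
move: (n %/ 2)%Z (d %/ 2)%Z (n %% 2)%Z (d %% 2)%Z n0 n1 d0 d1 => a b r s ? ? ? ? e.
have rr : r = 0 \/ r = 1 by lia.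
have ss : s = 0 \/ s = 1 by lia.
case: rr ss e => -> [] -> e; try (exfalso; nia); split; rewrite addr0 dvdz_mull //.
Qed.

Section CriticalRoot.
Variables (R : realType) (p : nat) (p_prime : prime p) (K : padicField R p).
Implicit Types x y z : K.

Local Notation N := (@padic_norm R p K).
Local Notation rho := (exp_radius R p).

Lemma padic_norm_cube_root1 (w : K) : w ^+ 3 = 1 -> N w = 1.
Proof.
move=> w3; apply/eqP; rewrite -(@eqrXn2 _ 3) ?padic_norm_ge0 //.
by rewrite -padic_normX w3 padic_norm1 expr1n.
Qed.

(** The difference is [y] times an integral factor, so closeness to any cube root of unity becomes
    closeness of the cube to 1. *)
Lemma padic_norm_cube1 (w y : K) : w ^+ 3 = 1 -> N y < 1 -> N ((w + y) ^+ 3 - 1) <= N y.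
Proof.
move=> w3 y1; have w1 := padic_norm_cube_root1 w3.
have -> : (w + y) ^+ 3 - 1 = y * (3%:R * (w * (w + y)) + y * y).
  by rewrite -[X in _ - X]w3; ring.
rewrite padic_normM ler_piMr ?padic_norm_ge0 //.
have wy : N (w + y) <= 1 by rewrite padic_normD_le ?w1 // ltW.
apply: padic_normD_le; rewrite !padic_normM.
  rewrite w1 mul1r mulr_ile1 ?padic_norm_ge0 //.
  exact: padic_norm_nat_le1.
by rewrite mulr_ile1 ?padic_norm_ge0 // ltW.
Qed.

Lemma padic_norm_int (k : int) : N k%:~R = N `|k|%:R.
Proof.
case: (intP k) => [//|n //|n]; rewrite abszN absz_nat mulrNz padic_normN //.
Qed.

Lemma padic_norm_nat_lt1 (n : nat) : N n%:R < 1 -> (p %| n)%N.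
Proof.
have [->|n0 h] := posnP n; first by rewrite dvdn0.
by apply: contraTT h => h; rewrite padic_norm_coprime // ltxx.
Qed.

(** A root is integral, and a rational at distance below 1 from it is a root modulo 2. Clearing
    denominators makes the norm form of a reduced fraction even, so both its terms would be even. *)
Lemma quadratic_residue2 (w : K) : p = 2%N -> w ^+ 2 + w + 1 != 0.
Proof.
move=> p2; apply/eqP => w0.
have w1 : N w <= 1.
  rewrite leNgt; apply/negP => w1; have : N (w ^+ 2) <= N w.
    have -> : w ^+ 2 = - (w + 1) by rewrite -(addr0 (- _)) -w0; ring.
    by rewrite padic_normN padic_normD_le // padic_norm1 ltW.
  by rewrite padic_normX expr2 ger_pMl ?(lt_trans ltr01) // leNgt w1.
have [r wr] := padic_rat_dense w (ltr01 : 0 < 1 :> R).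
have r1 : N (ratr r) <= 1.
  have -> : ratr r = w - (w - ratr r) by rewrite opprB addrC subrK.
  by rewrite padic_normB_le // ltW.
have rr : N (ratr r ^+ 2 + ratr r + 1) < 1.
  have -> : ratr r ^+ 2 + ratr r + 1 = - ((w - ratr r) * (w + ratr r + 1)).
    by rewrite -[LHS]subr0 -w0; ring.
  rewrite padic_normN padic_normM (le_lt_trans _ wr) // ler_piMr ?padic_norm_ge0 //.
  by rewrite !padic_normD_le // padic_norm1.
set n := numq r; set d := denq r.
have d0 : d%:~R != 0 :> K.
  rewrite -padic_norm_gt0 padic_norm_int // padic_norm_gt0 padic_natr_neq0 //.
  by rewrite absz_gt0 denq_neq0.
have : N (n ^+ 2 + n * d + d ^+ 2)%:~R < 1.
  have -> : (n ^+ 2 + n * d + d ^+ 2)%:~R =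
      d%:~R ^+ 2 * (ratr r ^+ 2 + ratr r + 1) :> K.
    by rewrite /ratr -/n -/d !(intrD, intrM, rmorphXn) /=; field.
  rewrite padic_normM padic_normX (le_lt_trans _ rr) // ler_piMl ?padic_norm_ge0 //.
  by rewrite exprn_ile1 ?padic_norm_ge0 // padic_norm_int padic_norm_nat_le1.
rewrite padic_norm_int => /padic_norm_nat_lt1; rewrite p2 => nd.
have [n2 d2] : (2 %| n)%Z /\ (2 %| d)%Z by apply: dvdz2_norm_form.
have := coprime_num_den r; rewrite -/n -/d => /eqP cop.
by have := dvdn_gcd 2 `|n| `|d|; move: n2 d2; rewrite cop !dvdzE /= => -> ->.
Qed.

Lemma padic_norm2 : (2 < p)%N -> N 2%:R = 1.
Proof.
move=> p2; apply: padic_norm_coprime => //.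
by apply/negP => /dvdn_leq; lia.
Qed.

Lemma padic_norm3 : (3 < p)%N -> N 3%:R = 1.
Proof.
move=> p2; apply: padic_norm_coprime => //.
by apply/negP => /dvdn_leq; lia.
Qed.

(** The norm of [s] would be the square root of 1/3, strictly between 1/3 and 1. *)
Lemma no_sqrtN3_at3 (s : K) : p = 3%N -> s ^+ 2 != - 3%:R.
Proof.
move=> p3; apply/eqP => s2.
have ns : N s ^+ 2 = 3%:R^-1.
  by rewrite -padic_normX s2 padic_normN -[X in N X%:R]p3 padic_norm_p // p3.
have s1 : N s < 1.
  rewrite ltNge; apply/negP => h; have := exprn_ege1 2 h.
  by rewrite ns invf_ge1 // lern1.
have := padic_norm_lt1 p_prime s1; rewrite [X in X%:R^-1]p3 => h.
have : N s ^+ 2 <= 3%:R^-1 ^+ 2 by rewrite lerXn2r ?nnegrE ?padic_norm_ge0.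
by rewrite ns; lra.
Qed.

(* Condition (d) excludes p = 2 and p = 3. *)
Lemma critical_root (m q : nat) : (0 < m)%N ->
  [\/ p = 2%N /\ padic_norm (q%:R / (2 * m)%:R - 1 : K) < 1 / 4%:R,
      p = 3%N /\ padic_norm (m%:R : K) <= padic_norm (q%:R : K),
      [/\ (3 < p)%N, padic_norm (m%:R : K) = padic_norm (q%:R : K) &
          padic_norm (q%:R - (2 * m)%:R : K) < padic_norm (q%:R : K)]
    | padic_norm (q%:R : K) < padic_norm (m%:R : K) /\
      exists s : K, s ^+ 2 = - 3%:R] ->
  exists2 x : K, m%:R * x ^+ 2 + (m%:R - q%:R / 2%:R) * x + (m%:R - q%:R) = 0 &
    N (x ^+ 3 - 1) < rho.
Proof.
move=> m0 H.
have mK : m%:R != 0 :> K by exact: padic_natr_neq0.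
have K2 : 2%:R != 0 :> K by exact: padic_natr_neq0.
have r1 := exp_radius_lt1 R p_prime.
(* With [r] = a/m the quadratic divided by [m] is x^2 + (1 - r) x + 1 - 2r; below it is expanded
   around [w]. *)
pose r : K := q%:R / (2 * m)%:R.
(* x = w + y with w = 1, or w^2 + w + 1 = 0 under (d) *)
have red (w y : K) : w ^+ 3 = 1 -> N y < rho ->
    y ^+ 2 + (2%:R * w + 1 - r) * y + (w ^+ 2 + w + 1 - r * (w + 2%:R)) = 0 ->
    exists2 x : K, m%:R * x ^+ 2 + (m%:R - q%:R / 2%:R) * x + (m%:R - q%:R) = 0 &
    N (x ^+ 3 - 1) < rho.
  move=> w3 yr e; exists (w + y).
    rewrite -(mulr0 m%:R) -e /r natrM; field; exact/andP.
  by apply: le_lt_trans (yr); apply: padic_norm_cube1 => //; apply: lt_trans yr r1.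
(* The first inequality is Hensel's condition |c| < |b|^2, the second places the root [y] within the
   radius. *)
have lift (w : K) (e : R) : w ^+ 3 = 1 -> e < rho ->
    N (w ^+ 2 + w + 1 - r * (w + 2%:R)) < N (2%:R * w + 1 - r) ^+ 2 ->
    N (w ^+ 2 + w + 1 - r * (w + 2%:R)) <= e * N (2%:R * w + 1 - r) ->
    exists2 x : K, m%:R * x ^+ 2 + (m%:R - q%:R / 2%:R) * x + (m%:R - q%:R) = 0 &
    N (x ^+ 3 - 1) < rho.
  move=> w3 er c1 c2; have [y ey ny] := padic_quadratic_root c1.
  apply: red w3 _ ey; apply: le_lt_trans ny _.
  have b0 : 0 < N (2%:R * w + 1 - r).
    rewrite lt_def padic_norm_ge0 andbT; apply: contraTneq c1 => ->.
    by rewrite expr0n /= ltNge padic_norm_ge0.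
  by apply: le_lt_trans er; rewrite ler_pdivrMr.
have rN : N r = N q%:R / (N 2%:R * N m%:R).
  by rewrite /r padic_norm_div natrM padic_normM.
have c1 : 1 ^+ 2 + 1 + 1 - r * (1 + 2%:R) = 3%:R * (1 - r) by ring.
have N3 : N (3%:R * (1 - r)) <= N (1 - r).
  by rewrite padic_normM ler_piMl ?padic_norm_ge0 // padic_norm_nat_le1.
have b1 : 2%:R * 1 + 1 - r = 2%:R + (1 - r) by ring.
case: H => [[p2 h]|[p3 h]|[p3 h1 h2]|[h [s s2]]].
(* Case (a): |b| = 1/2 and |c| <= |1 - r| < 1/4, so |y| <= 2 |1 - r| < 1/2, the radius at p = 2. *)
- have n2 : N 2%:R = 2%:R^-1 by rewrite -[X in N X%:R]p2 padic_norm_p // p2.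
  have rho2 : rho = 2%:R^-1.
    by have := exp_radiusX R p_prime; rewrite p2 expr1.
  have {}h : N (1 - r) < 1 / 4%:R by rewrite -padic_normN opprB.
  have Nb : N (2%:R + (1 - r)) = 2%:R^-1.
    by rewrite padic_normD_eq n2 //; apply: lt_trans h _; lra.
  apply: (lift 1 (2%:R * N (1 - r)) (expr1n _ _)); rewrite ?c1 ?b1 ?Nb.
  + by rewrite rho2; lra.
  + by apply: le_lt_trans N3 _; apply: lt_le_trans h _; lra.
  + by apply: le_trans N3 _; lra.
(* Case (b): |r| >= 1 dominates 3, so |b| = |r| while |c| <= |r|/3, and |y| <= 1/3. *)
- have n3 : N 3%:R = 3%:R^-1 by rewrite -[X in N X%:R]p3 padic_norm_p // p3.
  have r_ge1 : 1 <= N r.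
    rewrite rN padic_norm2 ?p3 // mul1r ler_pdivlMr ?padic_norm_gt0 //.
    by rewrite mul1r.
  have Nb : N (2%:R * 1 + 1 - r) = N r.
    rewrite addrC padic_normD_eq padic_normN //; apply: lt_le_trans r_ge1.
    have -> : 2%:R * 1 + 1 = 3%:R :> K by ring.
    by rewrite n3; lra.
  have Nc : N (3%:R * (1 - r)) <= 3%:R^-1 * N r.
    rewrite padic_normM n3 ler_wpM2l ?invr_ge0 ?ler0n //.
    by rewrite padic_normB_le ?padic_norm1.
  apply: (lift 1 3%:R^-1 (expr1n _ _)); rewrite ?c1 ?Nb.
  + by have := exp_radius_gt_pinv R p_prime; rewrite [X in X%:R^-1]p3 p3; apply.
  + by apply: le_lt_trans Nc _; nra.
  + exact: Nc.
(* Case (c): [r] is close to 1, so |b| = |2| = 1 and |c| <= |1 - r| <= 1/p. *)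
- have rho_p := exp_radius_gt_pinv R p_prime (ltnW p3).
  have lt1 : N (1 - r) < 1.
    have -> : 1 - r = - ((q%:R - (2 * m)%:R) / (2 * m)%:R).
      by rewrite /r natrM; field; exact/andP.
    rewrite padic_normN padic_norm_div natrM padic_normM padic_norm2 ?(ltnW p3) //.
    by rewrite mul1r ltr_pdivrMr ?padic_norm_gt0 // mul1r h1 -natrM.
  have Nb : N (2%:R + (1 - r)) = 1.
    by rewrite padic_normD_eq padic_norm2 // ltnW.
  apply: (lift 1 p%:R^-1 (expr1n _ _)); rewrite ?c1 ?b1 ?Nb ?expr1n ?mulr1 //.
  + exact: le_lt_trans N3 lt1.
  + by apply: le_trans N3 _; exact: padic_norm_lt1.
(* Case (d): a primitive cube root of unity kills w^2 + w + 1. What remains is b = s - r of norm 1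
   and c = - r (w + 2) of norm at most |r| < 1. *)
pose w := (s - 1) / 2%:R.
have w0 : w ^+ 2 + w + 1 = 0.
  have -> : w ^+ 2 + w + 1 = (s ^+ 2 + 3%:R) / 4%:R.
    by rewrite /w; field; rewrite padic_natr_neq0.
  by rewrite s2 addNr mul0r.
have w3 : w ^+ 3 = 1.
  apply/eqP; rewrite -subr_eq0.
  have -> : w ^+ 3 - 1 = (w - 1) * (w ^+ 2 + w + 1) by ring.
  by rewrite w0 mulr0.
have p3 : (3 < p)%N.
  have p1 := prime_gt1 p_prime.
  have [p2|[p3|//]] : p = 2%N \/ p = 3%N \/ (3 < p)%N by lia.
    by have := quadratic_residue2 w p2; rewrite w0 eqxx.
  by have := no_sqrtN3_at3 s p3; rewrite s2 eqxx.
have r_lt1 : N r < 1.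
  rewrite rN padic_norm2 ?(ltnW p3) // mul1r ltr_pdivrMr ?padic_norm_gt0 //.
  by rewrite mul1r.
have Ns : N s = 1.
  apply/eqP; rewrite -(@eqrXn2 _ 2) ?padic_norm_ge0 //.
  by rewrite -padic_normX s2 padic_normN padic_norm3 // expr1n.
have Nb : N (2%:R * w + 1 - r) = 1.
  have -> : 2%:R * w + 1 - r = s - r by rewrite /w; field.
  by rewrite padic_normD_eq // padic_normN Ns.
have Nw : N (w + 2%:R) <= 1.
  by rewrite padic_normD_le ?(padic_norm_cube_root1 w3) // padic_norm_nat_le1.
have Nc : N (w ^+ 2 + w + 1 - r * (w + 2%:R)) <= N r.
  by rewrite w0 sub0r padic_normN padic_normM ler_piMr ?padic_norm_ge0.
apply: (lift w p%:R^-1) => //; rewrite ?Nb ?expr1n ?mulr1.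
- exact: (exp_radius_gt_pinv R p_prime (ltnW p3)).
- exact: le_lt_trans Nc r_lt1.
- by apply: le_trans Nc _; exact: padic_norm_lt1.
Qed.

End CriticalRoot.

(** * Gibbs weights on the Cayley tree *)

Section TreeProducts.
Variables (k : nat) (T : comRingType).

Definition ball_widen n (x : ball k n) : ball k n.+1 := Sub (val x) (leqW (valP x)).

Lemma big_ball_split n (F : ball k n.+1 -> T) (P : pred (ball k n.+1)) :
  \prod_(x | P x) F x =
  (\prod_(x : ball k n | P (ball_widen x)) F (ball_widen x)) *
  \prod_(y : sphere k n.+1 | P (sphere_ball y)) F (sphere_ball y).
Proof.
rewrite (bigID (fun x : ball k n.+1 => height (val x) <= n)%N) /=.
congr (_ * _).
  rewrite (@reindex_omap _ _ _ _ _ (@ball_widen n) (fun x => insub (val x))) /=.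
    apply: eq_bigl => x; rewrite (valP x : (_ <= _)%N) andbT.
    by rewrite valK eqxx andbT.
  move=> x /andP[_ xn]; rewrite insubT /=; congr Some; exact: val_inj.
rewrite (@reindex_omap _ _ _ _ _ (@sphere_ball k n.+1) (@sphere_unball k n.+1)) /=.
  apply: eq_bigl => x; rewrite sphere_ballK eqxx andbT -ltnNge.
  by rewrite (eqP (valP x)) ltnSn andbT.
move=> x /andP[_]; rewrite -ltnNge => xn; rewrite /sphere_unball insubT /=.
  by rewrite eqn_leq xn (valP x).
by move=> h; congr Some; apply: val_inj.
Qed.

Lemma parent_subproof n (y : sphere k n.+1) : exists x, child x (val y).
Proof. by apply: parent_exists; rewrite (eqP (valP y)). Qed.

Definition parent_vertex n (y : sphere k n.+1) := xchoose (parent_subproof y).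

Lemma height_parent n (y : sphere k n.+1) : height (parent_vertex y) == n.
Proof.
have := child_height (xchooseP (parent_subproof y)).
by rewrite (eqP (valP y)) => /eqP; rewrite eqSS eq_sym.
Qed.

Definition parent n (y : sphere k n.+1) : sphere k n :=
  Sub (parent_vertex y) (height_parent y).

Lemma child_parent n (x : vertex k) (y : sphere k n.+1) :
  child x (val y) = (x == val (parent y)).
Proof.
have h : child (val (parent y)) (val y) by exact: (xchooseP (parent_subproof y)).
by apply/idP/eqP => [xy|-> //]; apply: child_inj xy h.
Qed.

(** The edges of the larger ball that are not in the smaller one correspond to the outer vertices,
    each joined to its parent. *)
Lemma edge_product_split n (g : ball k n.+1 -> ball k n.+1 -> T) :
  \prod_(x : ball k n.+1) \prod_(y : ball k n.+1 | child (val x) (val y)) g x y =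
  (\prod_(x : ball k n) \prod_(y : ball k n | child (val x) (val y))
     g (ball_widen x) (ball_widen y)) *
  \prod_(y : sphere k n.+1) g (ball_widen (sphere_ball (parent y))) (sphere_ball y).
Proof.
rewrite big_ball_split [X in _ * X]big1 ?mulr1 => [|x _]; last first.
  apply: big_pred0 => y; apply/negbTE/negP => /child_height e.
  by have := valP y; rewrite e (eqP (valP x)) ltnn.
under eq_bigr do rewrite big_ball_split.
rewrite big_split /=; congr (_ * _).
rewrite (exchange_big_dep xpredT) //=; apply: eq_bigr => y _.
rewrite (big_pred1 (sphere_ball (parent y))) // => x.
by rewrite child_parent.
Qed.

(** Children are indexed by the letters that keep the word reduced: all k+1 at the root, k
    elsewhere. *)
Lemma children_product n (x : sphere k n) (H : seq 'I_k.+1 -> T) :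
  \prod_(y : sphere k n.+1 | child (val x) (val y)) H (val (val y)) =
  \prod_(a : 'I_k.+1 | reduced (rcons (val (val x)) a)) H (rcons (val (val x)) a).
Proof.
pose s := val (val x).
pose last_letter (y : sphere k n.+1) := last ord0 (val (val y)).
pose extend a : option (sphere k n.+1) :=
  if (insub (rcons s a) : option (vertex k)) is Some v then insub v else None.
have extendE (y : sphere k n.+1) a :
    val (val y) = rcons s a -> extend a = Some y.
  by move=> e; rewrite /extend -e valK valK.
rewrite [RHS](reindex_omap last_letter extend) => [|a ra]; last first.
  have hx : height (Sub (rcons s a) ra : vertex k) == n.+1.
    by rewrite /height /= size_rcons eqSS; exact: (valP x).
  rewrite (extendE (Sub (Sub (rcons s a) ra) hx)) //=.
  by rewrite /last_letter /= last_rcons.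
apply: eq_big => [y|y /existsP[a /eqP e]]; last first.
  by rewrite /last_letter e last_rcons -e.
apply/existsP/andP => [[a /eqP e]|[ry /eqP]].
  by rewrite /last_letter e last_rcons (extendE _ _ e) -e (valP (val y)).
rewrite /extend (insubT _ ry) /= => h; exists (last_letter y).
move: h; case: insubP => [u _ e [uy]|_ h]; last by discriminate h.
by apply/eqP; rewrite -{1}uy e.
Qed.

End TreeProducts.

(** * Boundary laws and compatibility *)

Section BoundaryLaw.
Variables (R : realType) (p : nat) (p_prime : prime p) (K : padicField R p).
Variables (k q : nat) (J : K) (h : vertex k -> 'I_q -> K).
Hypothesis Jr : padic_norm J < exp_radius R p.
Hypothesis hr : forall x i, padic_norm (h x i) < exp_radius R p.

Definition edge_factor (i j : 'I_q) : K := if i == j then padic_exp J else 1.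

(** What [x] contributes to its parent in state [i] once the spin at [x] has been summed out. *)
Definition edge_message (x : vertex k) (i : 'I_q) : K :=
  \sum_j edge_factor i j * padic_exp (h x j).

(** The exponent is a sum of terms within the radius, so the exponential turns it into a product
    over edges and boundary vertices. *)
Lemma gibbs_weightE n (s : ball_config k q n) : gibbs_weight J h s =
  \prod_(x : ball k n) \prod_(y : ball k n | child (val x) (val y))
     edge_factor (s x) (s y) *
  \prod_(x : sphere k n) padic_exp (h (val x) (s (sphere_ball x))).
Proof.
rewrite /gibbs_weight /hamiltonian mulr_sumr.
have e (x y : ball k n) : padic_norm (J * (s x == s y)%:R) < exp_radius R p /\
    padic_exp (J * (s x == s y)%:R) = edge_factor (s x) (s y).
  rewrite /edge_factor; case: eqP => _; rewrite ?mulr1 ?mulr0 //.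
  by rewrite padic_norm0 exp_radius_gt0 // padic_exp0.
have e2 (x : ball k n) : padic_norm
      (J * \sum_(y : ball k n | child (val x) (val y)) (s x == s y)%:R) < exp_radius R p /\
    padic_exp (J * \sum_(y : ball k n | child (val x) (val y)) (s x == s y)%:R) =
    \prod_(y : ball k n | child (val x) (val y)) edge_factor (s x) (s y).
  have [u v] := padic_exp_sum p_prime (index_enum _)
    (P := fun y => child (val x) (val y)) (fun y _ => (e x y).1).
  rewrite mulr_sumr v.
  by split=> //; apply: eq_bigr => y _; rewrite (e x y).2.
have [u1 v1] := padic_exp_sum p_prime (index_enum _) (P := xpredT) (fun x _ => (e2 x).1).
have [u2 v2] := padic_exp_sum p_prime (index_enum _) (P := xpredT)
  (fun (x : sphere k n) _ => hr (val x) (s (sphere_ball x))).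
rewrite padic_expD // v1 v2; congr (_ * _).
by apply: eq_bigr => x _; rewrite (e2 x).2.
Qed.

Lemma join_widen n (s : ball_config k q n) w (x : ball k n) :
  join s w (ball_widen x) = s x.
Proof. exact: join_ball. Qed.

Lemma join_sphere_ball n (s : ball_config k q n) w (y : sphere k n.+1) :
  join s w (sphere_ball y) = w y.
Proof. exact: join_sphere. Qed.

Lemma sum_gibbs_weight_join n (s : ball_config k q n) :
  \sum_(w : sphere_config k q n.+1) gibbs_weight J h (join s w) =
  \prod_(x : ball k n) \prod_(y : ball k n | child (val x) (val y))
     edge_factor (s x) (s y) *
  \prod_(x : sphere k n) \prod_(y : sphere k n.+1 | child (val x) (val y))
     edge_message (val y) (s (sphere_ball x)).
Proof.
have E (w : sphere_config k q n.+1) : gibbs_weight J h (join s w) =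
    \prod_(x : ball k n) \prod_(y : ball k n | child (val x) (val y))
     edge_factor (s x) (s y) *
    \prod_(y : sphere k n.+1) (edge_factor (s (sphere_ball (parent y))) (w y)
       * padic_exp (h (val y) (w y))).
  rewrite gibbs_weightE (edge_product_split
    (fun x y => edge_factor (join s w x) (join s w y))).
  rewrite -mulrA; congr (_ * _).
    by apply: eq_bigr => x _; apply: eq_bigr => y _; rewrite !join_widen.
  rewrite -big_split; apply: eq_bigr => y _ /=.
  by rewrite join_widen join_sphere_ball.
under eq_bigr do rewrite E.
rewrite -mulr_sumr; congr (_ * _).
(* Distributivity: the sum over outer configurations of a product over outer vertices is the product
   of the one-vertex sums, then grouped by parent. *)
rewrite -(bigA_distr_bigA (fun y j => edge_factor (s (sphere_ball (parent y))) j
       * padic_exp (h (val y) j))) /=.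
rewrite (partition_big (@parent k n) xpredT) //=; apply: eq_bigr => x _.
apply: eq_big => [y|y /eqP -> //].
by rewrite child_parent -val_eqE eq_sym.
Qed.

Lemma join_bij n : bijective
  (fun sw : ball_config k q n * sphere_config k q n.+1 => join sw.1 sw.2).
Proof.
exists (fun t : ball_config k q n.+1 =>
  ([ffun x => t (ball_widen x)], [ffun y => t (sphere_ball y)])) => [[s w]|t] /=.
  by congr (_, _); apply/ffunP => x; rewrite ffunE ?join_widen ?join_sphere_ball.
apply/ffunP => x; have [xn|xn] := leqP (height (val x)) n.
  rewrite -[x in LHS](_ : ball_widen (Sub (val x) xn) = x); last exact: val_inj.
  by rewrite join_widen ffunE; congr (t _); apply: val_inj.
have xn1 : height (val x) == n.+1 by rewrite eqn_leq xn (valP x : (_ <= _)%N).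
rewrite -[x in LHS](_ : sphere_ball (Sub (val x) xn1) = x); last exact: val_inj.
by rewrite join_sphere_ball ffunE; congr (t _); apply: val_inj.
Qed.

Lemma sum_ball_config_succ n (F : ball_config k q n.+1 -> K) :
  \sum_t F t = \sum_(s : ball_config k q n)
    \sum_(w : sphere_config k q n.+1) F (join s w).
Proof.
rewrite pair_big /=; apply: (reindex (fun sw => join sw.1 sw.2)).
exact: onW_bij (join_bij n).
Qed.

Lemma ball0P (x : ball k 0) : val x = root k.
Proof.
by apply: val_inj; apply/size0nil/eqP; rewrite -leqn0; exact: (valP x).
Qed.

Definition root_ball : ball k 0 := Sub (root k) isT.
Definition root_sphere : sphere k 0 := Sub (root k) isT.

Definition root_config (i : 'I_q) : ball_config k q 0 := [ffun=> i].

Lemma root_config_bij : bijective root_config.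
Proof.
exists (fun s : ball_config k q 0 => s root_ball) => [i|s]; first by rewrite ffunE.
apply/ffunP => x; rewrite ffunE; congr (s _).
by apply: val_inj; rewrite !ball0P.
Qed.

Lemma gibbs_weight_root i :
  gibbs_weight J h (root_config i) = padic_exp (h (root k) i).
Proof.
rewrite gibbs_weightE big1 ?mul1r => [|x _]; last first.
  apply: big_pred0 => y; apply/negbTE/negP => /child_height.
  by rewrite !ball0P.
rewrite (big_pred1 root_sphere) => [|x]; first by rewrite ffunE.
apply/esym/eqP/val_inj; exact: (ball0P (sphere_ball x)).
Qed.

Lemma partition_fun0 : partition_fun J h 0 = \sum_i padic_exp (h (root k) i).
Proof.
rewrite /partition_fun (reindex root_config) /=; last exact: onW_bij root_config_bij.
by apply: eq_bigr => i _; exact: gibbs_weight_root.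
Qed.

(** The messages need to reproduce the law only up to a factor [c x] independent of the spin. These
    factors multiply to the ratio of consecutive partition functions and cancel. *)
Variable c : vertex k -> K.
Hypothesis c_neq0 : forall x, c x != 0.
Hypothesis boundary_law : forall n (x : sphere k n) i,
  \prod_(y : sphere k n.+1 | child (val x) (val y)) edge_message (val y) i =
  c (val x) * padic_exp (h (val x) i).
Hypothesis root_sum_neq0 : \sum_i padic_exp (h (root k) i) != 0.

Lemma sum_gibbs_weight n (s : ball_config k q n) :
  \sum_(w : sphere_config k q n.+1) gibbs_weight J h (join s w) =
  (\prod_(x : sphere k n) c (val x)) * gibbs_weight J h s.
Proof.
rewrite sum_gibbs_weight_join gibbs_weightE mulrCA; congr (_ * _).
by rewrite -big_split; apply: eq_bigr => x _; exact: boundary_law.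
Qed.

Lemma partition_funS n :
  partition_fun J h n.+1 = (\prod_(x : sphere k n) c (val x)) * partition_fun J h n.
Proof.
rewrite /partition_fun sum_ball_config_succ mulr_sumr.
by apply: eq_bigr => s _; exact: sum_gibbs_weight.
Qed.

Lemma partition_fun_neq0 n : partition_fun J h n != 0.
Proof.
elim: n => [|n IH]; first by rewrite partition_fun0.
by rewrite partition_funS mulf_neq0 // prodf_seq_neq0; apply/allP => x _; rewrite c_neq0.
Qed.

Lemma boundary_law_compatible : compatible J h.
Proof.
move=> n s; rewrite /finite_gibbs -mulr_sumr sum_gibbs_weight partition_funS.
rewrite invfM -mulrA mulrCA mulKf // prodf_seq_neq0.
by apply/allP => x _; rewrite c_neq0.
Qed.

End BoundaryLaw.

(** * Extension to the algebra of cylinders *)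

Section Extension.
Variables (R : realType) (p : nat) (K : padicField R p) (k q : nat).
Variables (J : K) (h : vertex k -> 'I_q -> K).
Hypothesis q_gt0 : (0 < q)%N.
Hypothesis Z_neq0 : forall n, partition_fun J h n != 0.
Hypothesis comp : compatible J h.

Definition cylinder_mass n (B : {set ball_config k q n}) : K :=
  \sum_(s in B) finite_gibbs J h s.

Definition ball_config_restrict n (t : ball_config k q n.+1) : ball_config k q n :=
  [ffun x => t (ball_widen x)].

Definition cylinder_lift n (B : {set ball_config k q n}) : {set ball_config k q n.+1} :=
  [set t | ball_config_restrict t \in B]%SET.

Lemma cylinder_liftE n (B : {set ball_config k q n}) :
  cylinder (cylinder_lift B) = cylinder B.
Proof.
apply/seteqP; split=> s; rewrite /cylinder /= inE;
  suff -> : ball_config_restrict (restrict n.+1 s) = restrict n s by [];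
  by apply/ffunP => x; rewrite !ffunE.
Qed.

Lemma cylinder_mass_lift n (B : {set ball_config k q n}) :
  cylinder_mass (cylinder_lift B) = cylinder_mass B.
Proof.
rewrite /cylinder_mass big_mkcond sum_ball_config_succ [RHS]big_mkcond /=.
apply: eq_bigr => s _; rewrite -comp.
have e w : ball_config_restrict (join s w) = s.
  by apply/ffunP => x; rewrite ffunE join_widen.
under eq_bigr do rewrite inE e.
by case: ifP => // _; rewrite big1.
Qed.

(** Any two cylinders can thus be compared at a common level. *)
Lemma cylinder_raise n m (B : {set ball_config k q n}) : (n <= m)%N ->
  exists2 C : {set ball_config k q m},
    cylinder C = cylinder B & cylinder_mass C = cylinder_mass B.
Proof.
elim: m => [|m IH].
  by rewrite leqn0 => /eqP e; subst n; exists B.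
rewrite leq_eqVlt => /predU1P[e|/IH[C e1 e2]].
  by subst n; exists B.
by exists (cylinder_lift C); rewrite ?cylinder_liftE ?cylinder_mass_lift.
Qed.

(** Outside the ball the configuration takes an arbitrary fixed spin. Hence a cylinder determines
    its base at a given level. *)
Lemma restrict_surj n (s : ball_config k q n) : exists t, restrict n t = s.
Proof.
exists (fun v => if insub v is Some x then s x else Ordinal q_gt0).
by apply/ffunP => x; rewrite ffunE valK.
Qed.

Lemma cylinder_inj n : injective (@cylinder k q n).
Proof.
move=> B C e; apply/setP => s; have [t <-] := restrict_surj s.
by apply/idP/idP => h'; [have : cylinder B t by []|have : cylinder C t by []];
  rewrite ?e // -e.
Qed.

Lemma cylinder_mass_unique n m
    (B : {set ball_config k q n}) (C : {set ball_config k q m}) :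
  cylinder B = cylinder C -> cylinder_mass B = cylinder_mass C.
Proof.
have [B' b1 b2] := cylinder_raise B (leq_maxl n m).
have [C' c1 c2] := cylinder_raise C (leq_maxr n m).
by rewrite -b1 -c1 -b2 -c2 => /cylinder_inj ->.
Qed.

(** The value is chosen through some presentation of [A] as a cylinder; by [cylinder_mass_unique]
    the presentation does not matter. *)
Definition cylinder_measure (A : cylinders k q) : K :=
  xget 0 [set v | exists n (B : {set ball_config k q n}),
                    val A = cylinder B /\ v = cylinder_mass B].

Lemma cylinder_measureE A n (B : {set ball_config k q n}) :
  val A = cylinder B -> cylinder_measure A = cylinder_mass B.
Proof.
move=> e; rewrite /cylinder_measure;
case: xgetP => [v _ [m [C [e' ->]]]|/(_ (cylinder_mass B))].
  by apply: cylinder_mass_unique; rewrite -e -e'.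
by case; exists n, B.
Qed.

Lemma cylindersP (A : cylinders k q) :
  exists n (B : {set ball_config k q n}), val A = cylinder B.
Proof. exact: (set_mem (valP A)). Qed.

Lemma cylinder_measure_additive : finitely_additive cylinder_measure.
Proof.
move=> A B C AB CAB.
have [n [A' eA]] := cylindersP A; have [m [B' eB]] := cylindersP B.
have [A1 a1 _] := cylinder_raise A' (leq_maxl n m).
have [B1 b1 _] := cylinder_raise B' (leq_maxr n m).
rewrite -a1 in eA; rewrite -b1 in eB.
have eC : val C = cylinder (A1 :|: B1)%SET.
  rewrite CAB eA eB; apply/seteqP; split=> s; rewrite /cylinder /= inE.
    by case=> ->; rewrite ?orbT.
  by case/orP; [left|right].
rewrite (cylinder_measureE eA) (cylinder_measureE eB) (cylinder_measureE eC).
rewrite /cylinder_mass (eq_bigl [predU A1 & B1]) => [|s]; last by rewrite inE.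
rewrite bigU //= finset.disjoints_subset.
(* A common element of the two bases would extend to a configuration in both cylinders. *)
apply/fintype.subsetP => s sA; rewrite inE; apply/negP => sB.
have [t ts] := restrict_surj s.
suff : set0 t by [].
by rewrite -AB eA eB; split; rewrite /cylinder /= ts.
Qed.

Lemma cylinder_measure_probability : padic_probability cylinder_measure.
Proof.
split=> [|A e]; first exact: cylinder_measure_additive.
have {}e : val A = cylinder ([set: ball_config k q 0])%SET.
  by rewrite e; apply/seteqP; split=> s //= _; rewrite /cylinder /= inE.
rewrite (cylinder_measureE e) /cylinder_mass /finite_gibbs.
under eq_bigl do rewrite inE.
by rewrite -mulr_sumr mulVf.
Qed.

Lemma cylinder_measure_finite_gibbs n (s : ball_config k q n) (A : cylinders k q) :
  val A = cylinder [set s]%SET -> cylinder_measure A = finite_gibbs J h s.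
Proof. by move=> /cylinder_measureE ->; rewrite /cylinder_mass big_set1. Qed.

End Extension.

(** * Boundary laws of the Potts model *)

Section PottsLaws.
Variables (R : realType) (p : nat) (p_prime : prime p) (K : padicField R p).
Variables (q : nat) (J : K).
Hypothesis q_gt0 : (0 < q)%N.
Hypothesis Jr : padic_norm J < exp_radius R p.

Local Notation a := (padic_exp J - 1).
(** Words starting with the letter 0: one of the four branches at the root, which does not contain
    the root itself. *)
Local Notation trivial_branch := (fun s : seq 'I_4 => ohead s == Some ord0).

(** A vertex with law xi^3 sends the message tau xi, and three such messages multiply to tau^3 xi^3,
    a multiple of the same law. *)
Variables (xi : 'I_q -> K) (tau : K).
Hypothesis xi3 : forall i, padic_norm (xi i ^+ 3 - 1) < exp_radius R p.
Hypothesis tau_neq0 : tau != 0.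
Hypothesis message_xi : forall i, \sum_j xi j ^+ 3 + a * xi i ^+ 3 = tau * xi i.
Hypothesis sum_neq0 : \sum_j xi j ^+ 3 != 0.
Hypothesis trivial_neq0 : q%:R + a != 0.

Lemma potts_measure : exists2 mu, gibbs_measures K 3 q J mu &
  forall i (A : cylinders 3 q), val A = cylinder [set root_config 3 i]%SET ->
    mu A = (\sum_j xi j ^+ 3)^-1 * xi i ^+ 3.
Proof.
have /choice[ell ellP] : forall i, exists l : K,
    padic_norm l < exp_radius R p /\ padic_exp l = xi i ^+ 3.
  by move=> i; have [l lr el] := padic_exp_onto p_prime (xi3 i); exists l.
pose h (v : vertex 3) i := if trivial_branch (val v) then 0 else ell i.
(* The trivial law sends the message q + a for every spin. The root receives one such message and
   three of the form tau xi; every other vertex receives three of its own kind. *)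
pose c (v : vertex 3) := if val v is _ :: _ then
   (if trivial_branch (val v) then (q%:R + a) ^+ 3 else tau ^+ 3)
   else (q%:R + a) * tau ^+ 3.
have hr v i : padic_norm (h v i) < exp_radius R p.
  by rewrite /h; case: ifP => _; rewrite ?padic_norm0 ?exp_radius_gt0 // (ellP i).1.
have exph v i : padic_exp (h v i) =
    if trivial_branch (val v) then 1 else xi i ^+ 3.
  by rewrite /h; case: ifP => _; rewrite ?padic_exp0 ?(ellP i).2.
have edgeE i j : edge_factor J i j = 1 + a * (j == i)%:R.
  rewrite /edge_factor eq_sym; case: eqP => _; rewrite ?mulr1 ?mulr0 ?addr0 //.
  by rewrite addrC subrK.
have msg v i : edge_message J h v i =
    if trivial_branch (val v) then q%:R + a else tau * xi i.
  rewrite /edge_message; under eq_bigr do rewrite edgeE exph mulrDl mul1r -mulrA.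
  rewrite big_split /= -mulr_sumr.
  have -> : \sum_j (j == i)%:R * (if trivial_branch (val v) then 1 else xi j ^+ 3) =
      if trivial_branch (val v) then 1 else xi i ^+ 3.
    rewrite (bigD1 i) //= eqxx mul1r big1 ?addr0 // => j /negPf ->.
    by rewrite mul0r.
  case: ifP => _; last exact: message_xi.
  by rewrite sumr_const card_ord mulr1.
have c_neq0 v : c v != 0.
  by rewrite /c; case: (val v) => [|b s]; [|case: ifP => _]; rewrite ?mulf_neq0 ?expf_neq0.
have law n (x : sphere 3 n) i :
    \prod_(y : sphere 3 n.+1 | child (val x) (val y)) edge_message J h (val y) i =
    c (val x) * padic_exp (h (val x) i).
  under eq_bigr do rewrite msg.
  rewrite (children_product x (fun s =>
    if trivial_branch s then q%:R + a else tau * xi i)).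
  rewrite exph /c; have := valP (val x); case/lastP: (val (val x)) => [_|s b rs] /=.
    by rewrite !big_mkcond /= !big_ord_recl big_ord0 /=; ring.
  (* Away from the root, children stay in the branch of their parent, and the three admissible
     letters are those different from the last letter [b]. *)
  have hd e : ohead (rcons (rcons s b) e) = ohead (rcons s b) by case: (s).
  under eq_bigr do rewrite hd.
  rewrite (eq_bigl (predC1 b)) => [|e]; last by rewrite reduced_rcons2 rs eq_sym.
  rewrite prodr_const cardC1 card_ord.
  have -> : rcons s b = head b s :: behead (rcons s b) by case: (s).
  by rewrite /=; case: ifP => _; ring.
have root_sum : \sum_i padic_exp (h (root 3) i) = \sum_j xi j ^+ 3.
  by apply: eq_bigr => i _; rewrite exph.
have root_sum0 : \sum_i padic_exp (h (root 3) i) != 0 by rewrite root_sum.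
have Z0 := partition_fun_neq0 p_prime Jr hr c_neq0 law root_sum0.
have comp := boundary_law_compatible p_prime Jr hr c_neq0 law.
exists (cylinder_measure J h) => [|i A eA].
  exists h; split=> // [v i||n s A].
  - exact: exp_domain_lt.
  - exact: cylinder_measure_probability.
  - exact: cylinder_measure_finite_gibbs.
rewrite (cylinder_measure_finite_gibbs q_gt0 comp eA) /finite_gibbs partition_fun0 //.
by rewrite gibbs_weight_root // exph root_sum.
Qed.

End PottsLaws.

(** * Algebra of the critical quadratic *)

Section CriticalAlgebra.
Variables (F : fieldType) (a m x : F).
Hypothesis root_x : m * x ^+ 2 + (m - a) * x + (m - 2%:R * a) = 0.
Hypothesis a_neq0 : a != 0.
Hypothesis ma : m != a.
Hypothesis three_neq0 : 3%:R != 0 :> F.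

(** The quadratic takes the value 3 (m - a) at 1. *)
Lemma critical_neq1 : x != 1.
Proof.
apply: contra_neq ma => x1; apply/eqP; rewrite -subr_eq0.
have /eqP : 3%:R * (m - a) = 0 by rewrite -root_x x1; ring.
by rewrite mulf_eq0 (negPf three_neq0).
Qed.

(** The quadratic takes the value m - a at -1. *)
Lemma critical_neqN1 : x != -1.
Proof.
apply: contra_neq ma => x1; apply/eqP; rewrite -subr_eq0.
by apply/eqP; rewrite -[RHS]root_x x1; ring.
Qed.

(** The quadratic is m (x^2 + x + 1) - a (x + 2), so a common root could only be -2, where x^2 + x +
    1 is 3. *)
Lemma critical_cyclotomic : x ^+ 2 + x + 1 != 0.
Proof.
apply/eqP => e.
have /eqP : a * (x + 2%:R) = 0.
  by rewrite -[RHS]subr0 -[X in X - _](mulr0 m) -{1}e -root_x; ring.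
rewrite mulf_eq0 (negPf a_neq0) /= addr_eq0 => /eqP x2.
by move/eqP: e; rewrite x2 (_ : _ + 1 = 3%:R) ?(negPf three_neq0) //; ring.
Qed.

Lemma critical_cube_neq1 : x ^+ 3 != 1.
Proof.
rewrite -subr_eq0 (_ : _ - 1 = (x - 1) * (x ^+ 2 + x + 1)); last by ring.
by rewrite mulf_neq0 ?critical_cyclotomic // subr_eq0 critical_neq1.
Qed.

(** In this lemma and the next, the two sides differ by x - 1 times the quadratic. With q = 2a they
    are the messages for spins off and on the set, in the ratio 1 to x, so tau = a (x^2 + x + 1). *)
Lemma critical_message_off : m * x ^+ 3 + (2%:R * a - m) + a = a * (x ^+ 2 + x + 1).
Proof.
apply/eqP; rewrite -subr_eq0.
by rewrite -[X in _ == X](mulr0 (x - 1)) -root_x; apply/eqP; ring.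
Qed.

Lemma critical_message_on :
  m * x ^+ 3 + (2%:R * a - m) + a * x ^+ 3 = a * (x ^+ 2 + x + 1) * x.
Proof.
apply/eqP; rewrite -subr_eq0.
by rewrite -[X in _ == X](mulr0 (x - 1)) -root_x; apply/eqP; ring.
Qed.

Lemma critical_sum_neq0 : x != 0 -> m * x ^+ 3 + (2%:R * a - m) != 0.
Proof.
move=> x0; have -> : m * x ^+ 3 + (2%:R * a - m) = a * x * (x + 1).
  by rewrite -[LHS](addrK a) critical_message_off; ring.
by rewrite !mulf_neq0 // addr_eq0 critical_neqN1.
Qed.

End CriticalAlgebra.

(** * Distinguishing and counting the measures *)

Lemma padic_natr_inj (R : realType) (p : nat) (p_prime : prime p) (K : padicField R p) :
  injective (fun n : nat => n%:R : K).
Proof.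
move=> m n; wlog mn : m n / (m <= n)%N.
  by move=> H e; have [/H|/ltnW/H] := leqP m n; [apply|move=> /(_ (esym e))].
move=> /eqP; rewrite -subr_eq0 -opprB oppr_eq0 -natrB // => e.
apply/eqP; rewrite eqn_leq mn -subn_eq0 -leqn0 leqNgt.
by apply/negP => /(padic_natr_neq0 p_prime K); rewrite e.
Qed.

Lemma sum_two_valued (F : nzRingType) (T : finType) (z : F) (L : {set T}) :
  \sum_j (if j \in L then z else 1) = #|L|%:R * z + (#|T| - #|L|)%:R.
Proof.
rewrite (bigID (fun j => j \in L)) /=; congr (_ + _).
  rewrite (eq_bigr (fun=> z)) => [|j]; last by move=> ->.
  by rewrite sumr_const mulr_natl.
rewrite (eq_bigr (fun=> 1)) => [|j]; last by move=> /negPf ->.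
have <- : #|~: L|%SET = (#|T| - #|L|)%N by rewrite cardsCs finset.setCK.
by rewrite -sumr_const; apply: eq_bigl => j; rewrite inE.
Qed.

(** A normalized law is constant for the empty set but not for a set of size [m], as 0 < m < #|T|.
    For two sets of size [m] the normalizing sums agree, so the laws agree and z <> 1 recovers the
    set. *)
Lemma potts_law_inj (F : fieldType) (T : finType) (m : nat) (z : F) (M M' : {set T}) :
  (0 < m < #|T|)%N -> z != 1 ->
  M = finset.set0 \/ #|M| = m -> M' = finset.set0 \/ #|M'| = m ->
  let law (L : {set T}) i := if i \in L then z else 1 in
  (forall i, (\sum_j law M j)^-1 * law M i = (\sum_j law M' j)^-1 * law M' i) ->
  \sum_j law M j != 0 -> \sum_j law M' j != 0 ->
  M = M'.
Proof.
move=> /andP[m0 mT] z1 hM hM' law e S0 S0'.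
have const L L' (i j : T) :
    (forall i, (\sum_j law L j)^-1 * law L i = (\sum_j law L' j)^-1 * law L' i) ->
    \sum_j law L j != 0 -> law L' i = law L' j -> law L i = law L j.
  move=> eL SL eij; apply: (mulfI (x := (\sum_j law L j)^-1)); first by rewrite invr_eq0.
  by rewrite !eL eij.
have flat (L : {set T}) : #|L| = m -> exists i j, law L i != law L j.
  move=> Lm; have /card_gt0P[i iL] : (0 < #|L|)%N by rewrite Lm.
  have : (0 < #|~: L|%SET)%N by rewrite cardsCs finset.setCK Lm subn_gt0.
  case/card_gt0P => j; rewrite inE => jL; exists i, j.
  by rewrite /law iL (negPf jL).
have law0 i : law finset.set0 i = 1 by rewrite /law inE.
case: hM => [M0|Mm]; case: hM' => [M0'|Mm'].
- by rewrite M0 M0'.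
- have [i [j /negP[]]] := flat _ Mm'; apply/eqP; apply: (const M' M) => //.
  by rewrite M0 !law0.
- have [i [j /negP[]]] := flat _ Mm; apply/eqP; apply: (const M M') => //.
  by rewrite M0' !law0.
apply/setP => i; have := e i; rewrite /law !sum_two_valued Mm Mm' => {}e.
have {}S0 : m%:R * z + (#|T| - m)%:R != 0 by move: S0; rewrite /law sum_two_valued Mm.
move: e.
move/(mulfI (invr_neq0 S0)).
by do 2!case: ifP => // _; move/eqP; rewrite ?(negPf z1) // eq_sym (negPf z1).
Qed.

Theorem theorem9 (R : realType) (p : nat) (p_prime : prime p)
    (K : padicField R p) (q m : nat) (J : K) :
  (2 <= q)%N ->
  padic_norm J < p%:R `^ (- (p.-1%:R)^-1) ->
  padic_exp J = 1 + q%:R / 2%:R ->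
  (1 <= m <= q - 1)%N ->
  q <> (2 * m)%N ->
  [\/ p = 2%N /\ padic_norm (q%:R / (2 * m)%:R - 1 : K) < 1 / 4%:R,
      p = 3%N /\ padic_norm (m%:R : K) <= padic_norm (q%:R : K),
      [/\ (3 < p)%N, padic_norm (m%:R : K) = padic_norm (q%:R : K) &
          padic_norm (q%:R - (2 * m)%:R : K) < padic_norm (q%:R : K)]
    | padic_norm (q%:R : K) < padic_norm (m%:R : K) /\
      exists s : K, s ^+ 2 = - 3%:R] ->
  [set: 'I_(1 + 'C(q, m))] #<= gibbs_measures K 3 q J.
Proof.
move=> q2 Jr Je /andP[m0 mq1] q2m cond.
have q0 : (0 < q)%N by apply: leq_trans q2.
have mq : (m < q)%N by lia.
have nat0 n : (0 < n)%N -> n%:R != 0 :> K := @padic_natr_neq0 R p p_prime K n.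
have [x root_x xr] := critical_root p_prime m0 cond.
pose a : K := q%:R / 2%:R; have n2 : 2%:R != 0 :> K := nat0 2%N isT.
have a2 : 2%:R * a = q%:R by rewrite /a; field.
have ea : padic_exp J - 1 = a by rewrite Je addrAC subrr add0r.
have a0 : a != 0 by rewrite mulf_neq0 ?invr_eq0 ?nat0.
have ma : m%:R != a.
  apply/eqP => e; apply: q2m; apply: (padic_natr_inj p_prime (K := K)).
  by rewrite natrM e a2.
have root_a : m%:R * x ^+ 2 + (m%:R - a) * x + (m%:R - 2%:R * a) = 0 by rewrite a2.
have n3 : 3%:R != 0 :> K by exact: nat0.
(* At x = 0 the norm of x^3 - 1 would be 1, outside the radius. *)
have x0 : x != 0.
  apply: contraTneq xr => ->; rewrite expr0n sub0r padic_normN padic_norm1 -leNgt.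
  exact/ltW/exp_radius_lt1.
have x3 := critical_cube_neq1 root_a a0 ma n3.
pose law (M : {set 'I_q}) i : K := if i \in M then x ^+ 3 else 1.
have q_m : (q - m)%:R = 2%:R * a - m%:R :> K by rewrite a2 natrB // ltnW.
have lawsum (M : {set 'I_q}) : M = finset.set0 \/ #|M| = m -> \sum_j law M j != 0.
  rewrite /law sum_two_valued card_ord => -[->|->].
    by rewrite cards0 mul0r add0r subn0 nat0.
  by rewrite q_m critical_sum_neq0.
(* The condition on [M] stands under the existential so that choice applies to all sets; the others
   get the zero function. *)
have measure (M : {set 'I_q}) : exists mu : cylinders 3 q -> K,
    M = finset.set0 \/ #|M| = m ->
    gibbs_measures K 3 q J mu /\
    forall i (A : cylinders 3 q), val A = cylinder [set root_config 3 i]%SET ->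
      mu A = (\sum_j law M j)^-1 * law M i.
  have [hM|hM] := pselect (M = finset.set0 \/ #|M| = m); last by exists (fun=> 0).
  pose xi i : K := if i \in M then x else 1.
  have xi3 i : xi i ^+ 3 = law M i by rewrite /xi /law; case: ifP; rewrite ?expr1n.
  have sumE : \sum_j xi j ^+ 3 = \sum_j law M j by apply: eq_bigr => j _.
  (* For the empty set [xi] is constantly 1 and the message is q + a, which equals 3a. *)
  pose tau : K := if M == finset.set0 then q%:R + a else a * (x ^+ 2 + x + 1).
  have qa : q%:R + a != 0.
    have -> : q%:R + a = 3%:R * a by rewrite -a2; ring.
    by rewrite mulf_neq0.
  have tau0 : tau != 0.
    by rewrite /tau; case: ifP => // _; rewrite mulf_neq0 // (critical_cyclotomic root_a).
  have [|i|||mu mu1 mu2] := @potts_measure R p p_prime K q J q0 Jr xi tau _ tau0.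
  - move=> i; rewrite xi3 /law; case: ifP => // _.
    by rewrite subrr padic_norm0 exp_radius_gt0.
  - rewrite sumE ea xi3 /law sum_two_valued card_ord /tau.
    case: hM => hM.
      by rewrite hM eqxx cards0 mul0r add0r subn0 /xi hM !inE !mulr1.
    have -> : (M == finset.set0) = false by rewrite -cards_eq0 hM gtn_eqF.
    rewrite hM q_m /xi; case: ifP => _.
      exact: critical_message_on.
    by rewrite !mulr1; exact: critical_message_off.
  - by rewrite sumE lawsum.
  - by rewrite ea.
  exists mu => _; split=> // i A /mu2 ->; by rewrite sumE xi3.
have [mu muP] := choice measure.
(* The empty set stands for the trivial law and gives the extra 1 in the count; it is not among the
   sets of size [m] because m > 0. *)
pose D := (finset.set0 |: [set M : {set 'I_q} | #|M| == m])%SET.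
have DP M : M \in D -> M = finset.set0 \/ #|M| = m.
  by rewrite !inE => /orP[/eqP|/eqP]; [left|right].
have cardD : #|D| = (1 + 'C(q, m))%N.
  rewrite cardsU1 !inE cards0 eq_sym gtn_eqF //= card_draws.
  by rewrite card_ord.
pose f (i : 'I_(1 + 'C(q, m))) : {set 'I_q} := enum_val (cast_ord (esym cardD) i).
have fD i : f i \in D by exact: enum_valP.
have f_inj : injective f by move=> i j /enum_val_inj /cast_ord_inj.
suff /injfunPex[g] : exists2 g : 'I_(1 + 'C(q, m)) -> (cylinders 3 q -> K),
    set_fun [set: _] (gibbs_measures K 3 q J) g & set_inj [set: _] g.
  exact: inj_card_le.
exists (fun i => mu (f i)) => [i _|]; first exact: (muP _ (DP _ (fD i))).1.
move=> i j _ _ e; apply: f_inj.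
have hi := DP _ (fD i); have hj := DP _ (fD j).
apply: (@potts_law_inj K 'I_q m (x ^+ 3)) => //; rewrite ?card_ord ?m0 //.
(* Equal measures agree on the cylinder that fixes the root spin to [t], where their values are the
   normalized laws. *)
- move=> t.
  have [A eA] : exists A : cylinders 3 q, val A = cylinder [set root_config 3 t]%SET.
    have cA : cylinder [set root_config 3 t]%SET \in cylinders 3 q.
      by apply/mem_set; exists 0%N, [set root_config 3 t]%SET.
    by exists (SigSub cA).
  by rewrite -[LHS]((muP _ hi).2 t A eA) -[RHS]((muP _ hj).2 t A eA) e.
- exact: lawsum.
- exact: lawsum.
Qed.
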